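(* Let $T$ be a monad on a finitely complete category $\mathcal V$. Regarding the category $T\text{-}\mathrm{Alg}$ of $T$-algebras as a monoidal category via cartesian product, one has an isomorphism of categories $$T^\times\text{-}\mathrm{Cat}\cong(T\text{-}\mathrm{Alg})\text{-}\mathrm{Cat}$$ commuting with the forgetful functors into $\mathrm{Set}$ (taking object sets).
   Context: A multitensor on $\mathcal V$ consists of functors $E_n:\mathcal V^n\to\mathcal V$ ($n\in\mathbb N$) and natural maps $u_X:X\to E_1X$ and $\sigma:E_k(E_{n_1}(X_{11},\dots,X_{1n_1}),\dots,E_{n_k}(X_{k1},\dots,X_{kn_k}))\to E_{n_1+\dots+n_k}(X_{11},\dots,X_{kn_k})$ for all $k,n_i\ge0$, such that $\sigma\circ u_{E_n(X_1,\dots,X_n)}=\mathrm{id}$, $\sigma\circ E_n(u,\dots,u)=\mathrm{id}$, and the two composites of $\sigma$'s from a threefold nested application of $E$ to the single application are equal. For a multitensor $E$, an $E$-category is a set $X_0$ of objects, objects $X(x,y)\in\mathcal V$ for $x,y\in X_0$, and maps $\kappa:E_n(X(x_0,x_1),\dots,X(x_{n-1},x_n))\to X(x_0,x_n)$ for all $n\in\mathbb N$ and $x_0,\dots,x_n\in X_0$, with $\kappa\circ u=\mathrm{id}$ on each $X(x_0,x_1)$ and $\kappa\circ\sigma=\kappa\circ E_k(\kappa,\dots,\kappa)$. An $E$-functor is a function $f_0:X_0\to Y_0$ with maps $X(x,y)\to Y(f_0x,f_0y)$ commuting with the $\kappa$'s. These form the category $E\text{-}\mathrm{Cat}$. For a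 monad $(T,\eta,\mu)$ on $\mathcal V$, $T^\times$ is the multitensor on $\mathcal V$ with $T^\times_n(X_1,\dots,X_n)=\prod_{1\le i\le n}TX_i$, $u=\eta$, and $\sigma$ the composite $$\textstyle\prod_iT\prod_jTX_{ij}\to\prod_i\prod_jT^2X_{ij}\to\prod_{ij}TX_{ij},$$ where the first map is the product over $i$ of the canonical comparison $T\prod_jTX_{ij}\to\prod_jT^2X_{ij}$ and the second is induced by $\mu$ and the canonical isomorphism $\prod_i\prod_j\cong\prod_{ij}$. *)

(* Defs.v *)
From mathcomp Require Import all_boot.
From mathcomp Require Import boolp classical_sets functions cardinality.

Set Implicit Arguments.
Unset Strict Implicit.
Unset Printing Implicit Defensive.
#[local] Obligation Tactic := idtac.

Declare Scope cat_scope.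
Delimit Scope cat_scope with cat.
Local Open Scope cat_scope.

Record Category := {
  obj :> Type;
  hom : obj -> obj -> Type;
  idm : forall x, hom x x;
  comp : forall x y z, hom y z -> hom x y -> hom x z;
  compA : forall x y z w (h : hom z w) (g : hom y z) (f : hom x y),
    comp h (comp g f) = comp (comp h g) f;
  comp1m : forall x y (f : hom x y), comp (idm y) f = f;
  compm1 : forall x y (f : hom x y), comp f (idm x) = f
}.
Arguments hom {_} _ _.
Arguments idm {_} _.
Arguments comp {_ _ _ _} _ _.
Notation "g ∘ f" := (comp g f) (at level 40, left associativity) : cat_scope.

Definition is_iso (C : Category) (x y : C) (f : hom x y) : Prop :=
  exists g : hom y x, g ∘ f = idm x /\ f ∘ g = idm y.

Definition cast_hom (C : Category) (x y : C) (e : x = y) : hom x y :=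
  let: erefl := e in idm x.
Arguments cast_hom : simpl never.

Record Functor (C D : Category) := {
  fob :> C -> D;
  fmap : forall x y, hom x y -> hom (fob x) (fob y);
  fmap1 : forall x, fmap (idm x) = idm (fob x);
  fmapM : forall x y z (g : hom y z) (f : hom x y),
    fmap (g ∘ f) = fmap g ∘ fmap f
}.
Arguments fmap {_ _} _ {_ _} _.

Definition id_functor (C : Category) : Functor C C :=
  {| fob := fun x => x; fmap := fun _ _ f => f;
     fmap1 := fun _ => erefl; fmapM := fun _ _ _ _ _ => erefl |}.

Program Definition comp_functor (C D E : Category)
    (G : Functor D E) (F : Functor C D) : Functor C E :=
  {| fob := fun x => G (F x); fmap := fun _ _ f => fmap G (fmap F f) |}.
Next Obligation. by move=> * /=; rewrite !fmap1. Qed.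
Next Obligation. by move=> * /=; rewrite !fmapM. Qed.

Definition SetCat : Category :=
  {| obj := Type; hom := fun A B => A -> B;
     idm := fun _ a => a; comp := fun _ _ _ g f a => g (f a);
     compA := fun _ _ _ _ _ _ _ => erefl;
     comp1m := fun _ _ _ => erefl; compm1 := fun _ _ _ => erefl |}.

(* Equality of functors is strict (Leibniz) equality, so this is isomorphism,
   not equivalence, of categories. *)
Definition isomorphic_over (S A B : Category)
    (U : Functor A S) (V : Functor B S) : Prop :=
  exists (F : Functor A B) (G : Functor B A),
    [/\ comp_functor G F = id_functor A,
        comp_functor F G = id_functor B &
        comp_functor V F = U].

Record Cone (J C : Category) (D : Functor J C) := {
  apex : C;
  leg : forall j, hom apex (D j);
  legN : forall i j (f : hom i j), fmap D f ∘ leg i = leg j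
}.

Record Limit (J C : Category) (D : Functor J C) := {
  lim_cone :> Cone D;
  lim_med : forall K : Cone D, hom (apex K) (apex lim_cone);
  lim_medP : forall (K : Cone D) j, leg lim_cone j ∘ lim_med K = leg K j;
  lim_uniq : forall (K : Cone D) (m : hom (apex K) (apex lim_cone)),
    (forall j, leg lim_cone j ∘ m = leg K j) -> m = lim_med K
}.

Definition finite_category (J : Category) : Prop :=
  finite_set [set: J]%classic /\
  forall i j : J, finite_set [set: hom i j]%classic.

Definition FinitelyComplete (C : Category) : Type :=
  forall J : Category, finite_category J -> forall D : Functor J C, Limit D.

Section Products.
Variable C : Category.
Implicit Types (A B : C) (s t : seq C).

(* Families of morphisms from A to the successive entries of s, that is, cones
   over s. *)
Fixpoint legs A s : Type :=
  if s is x :: s' then (hom A x * legs A s')%type else unit.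

Fixpoint lpre A B s (f : hom B A) : legs A s -> legs B s :=
  if s is x :: s' then fun l => (l.1 ∘ f, lpre f l.2) else fun l => l.

Record Product s := {
  prd :> C;
  prj : legs prd s;
  tup : forall A, legs A s -> hom A prd;
  tupK : forall A (l : legs A s), lpre (tup l) prj = l;
  prjK : forall A (f : hom A prd), tup (lpre f prj) = f
}.

Definition FinProducts : Type := forall s, Product s.

Lemma lpre1 A s (l : legs A s) : lpre (idm A) l = l.
Proof. by elim: s l => //= x s IH [f l] /=; rewrite compm1 IH. Qed.

Lemma lpreM A B D s (l : legs A s) (f : hom B A) (g : hom D B) :
  lpre (f ∘ g) l = lpre g (lpre f l).
Proof. by elim: s l => //= x s IH [h l] /=; rewrite compA IH. Qed.

Lemma prod_ext s (P : Product s) A (f g : hom A P) :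
  lpre f (prj P) = lpre g (prj P) -> f = g.
Proof. by move=> e; rewrite -(prjK f) -(prjK g) e. Qed.

Lemma tup_pre s (P : Product s) A B (l : legs A s) (f : hom B A) :
  tup P l ∘ f = tup P (lpre f l).
Proof. by apply: (@prod_ext _ P); rewrite lpreM !tupK. Qed.

End Products.

Definition Discrete (I : Type) : Category :=
  {| obj := I; hom := fun i j => i = j; idm := fun _ => erefl;
     comp := fun _ _ _ g f => etrans f g;
     compA := fun _ _ _ _ _ _ _ => Prop_irrelevance _ _;
     comp1m := fun _ _ _ => Prop_irrelevance _ _;
     compm1 := fun _ _ _ => Prop_irrelevance _ _ |}.

Lemma discrete_finite (I : finType) : finite_category (Discrete I).
Proof.
split=> [|i j]; first exact: finite_finset.
have [e|ne] := pselect (i = j).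
  rewrite (_ : setT = set1 (e : @hom (Discrete I) i j)); first exact: finite_set1.
  by apply/seteqP; split=> // e' _ /=; apply: Prop_irrelevance.
rewrite (_ : setT = set0); first exact: finite_set0.
by apply/seteqP; split=> // e' _ /=; apply: ne.
Qed.

Program Definition discrete_functor (C : Category) (I : Type) (X : I -> C) :
    Functor (Discrete I) C :=
  {| fob := X; fmap := fun i j (e : i = j) => cast_hom (congr1 X e) |}.
Next Obligation. by []. Qed.
Next Obligation.
by move=> C I X x y z g f /=; case: _ / g; case: _ / f; rewrite comp1m.
Qed.

Section FiniteProductsFromLimits.
Variables (C : Category) (lim : FinitelyComplete C).

Fixpoint index_type (s : seq C) : finType :=
  if s is _ :: s' then option (index_type s') else void.

Fixpoint entry (s : seq C) : index_type s -> C :=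
  match s with
  | [::] => of_void _
  | x :: s' => fun i => if i is Some j then entry j else x
  end.

Definition family_limit (s : seq C) : Limit (discrete_functor (@entry s)) :=
  lim (discrete_finite (index_type s)) (discrete_functor (@entry s)).

Fixpoint legs_of (A : C) (s : seq C) :
    (forall i : index_type s, hom A (entry i)) -> legs A s :=
  match s with
  | [::] => fun _ => tt
  | x :: s' => fun f => (f None, legs_of (fun j => f (Some j)))
  end.

Fixpoint leg_at (A : C) (s : seq C) :
    legs A s -> forall i : index_type s, hom A (entry i) :=
  match s with
  | [::] => fun _ i => match i with end
  | x :: s' => fun l i =>
      if i is Some j then leg_at l.2 j else l.1
  end.

Lemma legs_ofK A s (f : forall i : index_type s, hom A (entry i)) i :
  leg_at (legs_of f) i = f i.
Proof. by elim: s f i => [|x s IH] f [] //= i; rewrite IH. Qed.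

Lemma leg_atK A s (l : legs A s) : legs_of (leg_at l) = l.
Proof.
elim: s l => [|x s IH] /= => [[]//|[f l]] /=.
by congr pair; rewrite -[RHS]IH.
Qed.

Lemma legs_of_pre A B s (f : forall i : index_type s, hom A (entry i))
  (g : hom B A) : lpre g (legs_of f) = legs_of (fun i => f i ∘ g).
Proof. by elim: s f => //= x s IH f; rewrite IH. Qed.

Lemma legs_of_eq A s (f g : forall i : index_type s, hom A (entry i)) :
  (forall i, f i = g i) -> legs_of f = legs_of g.
Proof.
elim: s f g => //= x s IH f g e; rewrite e; congr pair.
by apply: IH => i; exact: (e (Some i)).
Qed.

Program Definition cone_of_legs (A : C) (s : seq C) (l : legs A s) :
    Cone (discrete_functor (@entry s)) :=
  {| apex := A; leg := leg_at l |}.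
Next Obligation. by move=> A s l i j f /=; case: _ / f; rewrite /cast_hom /= comp1m. Qed.

Program Definition products_of_limits : FinProducts C := fun s =>
  {| prd := apex (family_limit s);
     prj := legs_of (leg (family_limit s));
     tup := fun A l => lim_med (family_limit s) (cone_of_legs l) |}.
Next Obligation.
move=> s A l; rewrite legs_of_pre -[RHS]leg_atK; apply: legs_of_eq => i.
exact: (lim_medP (family_limit s) (cone_of_legs l) i).
Qed.
Next Obligation.
move=> s A f; apply/esym.
apply: (lim_uniq (K := cone_of_legs (lpre f (legs_of (leg (family_limit s)))))).
by move=> j /=; rewrite legs_of_pre legs_ofK.
Qed.

End FiniteProductsFromLimits.

Section Rel2.
Variables (A B : Type) (R : A -> B -> Type).

(* Sequences of witnesses of R between entries in the same position; there
   are none when the two sequences have different lengths. *)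
Fixpoint rel2 (s : seq A) (t : seq B) : Type :=
  match s, t with
  | [::], [::] => unit
  | x :: s', y :: t' => (R x y * rel2 s' t')%type
  | _, _ => Empty_set
  end.

Fixpoint rel2_cat (s1 : seq A) (t1 : seq B) (s2 : seq A) (t2 : seq B) :
    rel2 s1 t1 -> rel2 s2 t2 -> rel2 (s1 ++ s2) (t1 ++ t2) :=
  match s1, t1 with
  | [::], [::] => fun _ k => k
  | x :: s', y :: t' => fun h k => (h.1, rel2_cat h.2 k)
  | _, _ => fun h => match h with end
  end.

End Rel2.

Fixpoint rel2_flatten (A B : Type) (R : A -> B -> Type)
    (ss : seq (seq A)) (ts : seq (seq B)) :
    rel2 (rel2 R) ss ts -> rel2 R (flatten ss) (flatten ts) :=
  match ss, ts with
  | [::], [::] => fun h => h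
  | s :: ss', t :: ts' => fun h => rel2_cat h.1 (rel2_flatten h.2)
  | _, _ => fun h => match h with end
  end.

Fixpoint rel2_map (A B A' B' : Type) (R : A -> B -> Type)
    (R' : A' -> B' -> Type) (f : A -> A') (g : B -> B')
    (k : forall x y, R x y -> R' (f x) (g y)) (s : seq A) (t : seq B) :
    rel2 R s t -> rel2 R' (map f s) (map g t) :=
  match s, t with
  | [::], [::] => fun h => h
  | x :: s', y :: t' => fun h => (k x y h.1, rel2_map k h.2)
  | _, _ => fun h => match h with end
  end.

(* The morphisms of the disjoint union over n of the categories C^n, whose
   objects are the finite sequences of objects of C. *)
Definition homs (C : Category) : seq C -> seq C -> Type := rel2 hom.

Fixpoint idms (C : Category) (s : seq C) : homs s s :=
  if s is x :: s' then (idm x, idms s') else tt.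

Fixpoint comps (C : Category) (s t u : seq C) :
    homs t u -> homs s t -> homs s u :=
  match s, t, u with
  | [::], [::], [::] => fun _ _ => tt
  | x :: s', y :: t', z :: u' => fun g f => (g.1 ∘ f.1, comps g.2 f.2)
  | [::], [::], _ :: _ => fun g _ => match g with end
  | [::], _ :: _, _ => fun _ f => match f with end
  | _ :: _, [::], _ => fun _ f => match f with end
  | _ :: _, _ :: _, [::] => fun g _ => match g with end
  end.

Definition fmaps (C D : Category) (F : Functor C D) (s t : seq C) :
    homs s t -> homs (map F s) (map F t) :=
  @rel2_map _ _ _ _ hom hom F F (fun x y f => fmap F f) s t.

Lemma flatten_flatten (T : Type) (sss : seq (seq (seq T))) :
  flatten (map flatten sss) = flatten (flatten sss).
Proof. by elim: sss => //= ss sss ->; rewrite flatten_cat. Qed.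

(* The functors E_n : C^n -> C for all n are packed into a single functor
   from the category of finite sequences of objects of C. *)
Record FamilyFunctor (C : Category) := {
  mt_ob :> seq C -> C;
  mt_map : forall s t : seq C, homs s t -> hom (mt_ob s) (mt_ob t);
  mt_map1 : forall s, mt_map (idms s) = idm (mt_ob s);
  mt_mapM : forall s t u (g : homs t u) (f : homs s t),
    mt_map (comps g f) = mt_map g ∘ mt_map f
}.
Arguments mt_map {_} _ {_ _} _.

Section MultitensorData.
Variables (C : Category) (E : FamilyFunctor C).
Variable u : forall x : C, hom x (E [:: x]).
Variable sigma : forall ss : seq (seq C), hom (E (map E ss)) (E (flatten ss)).

Fixpoint mt_us (s : seq C) : homs s (map E (map (fun x => [:: x]) s)) :=
  if s is x :: s' then (u x, mt_us s') else tt.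

Fixpoint mt_sigmas (sss : seq (seq (seq C))) :
    homs (map E (map (map E) sss)) (map E (map flatten sss)) :=
  if sss is ss :: sss' then (sigma ss, mt_sigmas sss') else tt.

End MultitensorData.

Record Multitensor (C : Category) := {
  mt_fun :> FamilyFunctor C;
  mt_u : forall x : C, hom x (mt_fun [:: x]);
  mt_uN : forall (x y : C) (f : hom x y),
    mt_u y ∘ f = mt_map mt_fun ((f, tt) : homs [:: x] [:: y]) ∘ mt_u x;
  mt_sigma : forall ss : seq (seq C),
    hom (mt_fun (map mt_fun ss)) (mt_fun (flatten ss));
  mt_sigmaN : forall (ss ts : seq (seq C)) (h : rel2 (@homs C) ss ts),
    mt_sigma ts ∘ mt_map mt_fun (rel2_map (@mt_map C mt_fun) h) =
    mt_map mt_fun (rel2_flatten h) ∘ mt_sigma ss;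
  mt_sigma_u : forall s : seq C,
    mt_sigma [:: s] ∘ mt_u (mt_fun s) =
    cast_hom (congr1 mt_fun (esym (cats0 s)));
  mt_sigma_us : forall s : seq C,
    mt_sigma (map (fun x => [:: x]) s) ∘ mt_map mt_fun (mt_us mt_u s) =
    cast_hom (congr1 mt_fun (esym (flatten_seq1 s)));
  mt_sigmaA : forall sss : seq (seq (seq C)),
    cast_hom (congr1 mt_fun (flatten_flatten sss)) ∘
      mt_sigma (map flatten sss) ∘ mt_map mt_fun (mt_sigmas mt_sigma sss) =
    mt_sigma (flatten sss) ∘
      cast_hom (congr1 mt_fun (esym (map_flatten mt_fun sss))) ∘
      mt_sigma (map (map mt_fun) sss)
}.
Arguments mt_u {_} _ _.
Arguments mt_sigma {_} _ _.

Section ECategoryData.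
Variables (C : Category) (E : FamilyFunctor C) (X0 : Type) (X : X0 -> X0 -> C).

(* The points x_0, ..., x_n are given as x_0 and the sequence x_1, ..., x_n, so
   that pairmap X x s is the sequence X(x_0,x_1), ..., X(x_{n-1},x_n).
   For a sequence ss of k consecutive blocks of points after x, the end points
   of the blocks are scanl last x ss, and path_blocks x ss is the sequence of
   the k sequences of hom objects along the blocks. *)
Fixpoint path_blocks (x : X0) (ss : seq (seq X0)) : seq (seq C) :=
  if ss is s :: ss' then pairmap X x s :: path_blocks (last x s) ss' else [::].

Lemma flatten_path_blocks x ss :
  pairmap X x (flatten ss) = flatten (path_blocks x ss).
Proof. by elim: ss x => //= s ss IH x; rewrite pairmap_cat IH. Qed.

Lemma last_scanl_last (x : X0) (ss : seq (seq X0)) :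
  last x (flatten ss) = last x (scanl (fun y s => last y s) x ss).
Proof. by elim: ss x => //= s ss IH x; rewrite last_cat IH. Qed.

Variable kappa : forall (x : X0) (s : seq X0),
  hom (E (pairmap X x s)) (X x (last x s)).

Fixpoint ec_kappas (x : X0) (ss : seq (seq X0)) :
    homs (map E (path_blocks x ss))
         (pairmap X x (scanl (fun y s => last y s) x ss)) :=
  if ss is s :: ss' then (kappa x s, ec_kappas (last x s) ss') else tt.

End ECategoryData.

Record ECategory (C : Category) (E : Multitensor C) := {
  ec_ob :> Type;
  ec_hom : ec_ob -> ec_ob -> C;
  ec_kappa : forall (x : ec_ob) (s : seq ec_ob),
    hom (E (pairmap ec_hom x s)) (ec_hom x (last x s));
  ec_kappa_u : forall x y : ec_ob,
    ec_kappa x [:: y] ∘ mt_u E (ec_hom x y) = idm (ec_hom x y);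
  ec_kappa_sigma : forall (x : ec_ob) (ss : seq (seq ec_ob)),
    ec_kappa x (flatten ss) ∘
      cast_hom (congr1 E (esym (flatten_path_blocks ec_hom x ss))) ∘
      mt_sigma E (path_blocks ec_hom x ss) =
    cast_hom (congr1 (ec_hom x) (esym (last_scanl_last x ss))) ∘
      ec_kappa x (scanl (fun y s => last y s) x ss) ∘
      mt_map E (ec_kappas ec_kappa x ss)
}.
Arguments ec_hom {_ _} _ _ _.
Arguments ec_kappa {_ _} _ _ _.

Fixpoint pairmaps (C : Category) (X0 Y0 : Type) (X : X0 -> X0 -> C)
    (Y : Y0 -> Y0 -> C) (f0 : X0 -> Y0)
    (f : forall x y, hom (X x y) (Y (f0 x) (f0 y))) (x : X0) (s : seq X0) :
    homs (pairmap X x s) (pairmap Y (f0 x) (map f0 s)) :=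
  if s is y :: s' then (f x y, pairmaps f y s') else tt.

Record EFunctor (C : Category) (E : Multitensor C) (X Y : ECategory E) := {
  ef_ob :> X -> Y;
  ef_hom : forall x y, hom (ec_hom X x y) (ec_hom Y (ef_ob x) (ef_ob y));
  ef_kappa : forall (x : X) (s : seq X),
    ef_hom x (last x s) ∘ ec_kappa X x s =
    cast_hom (congr1 (ec_hom Y (ef_ob x)) (last_map ef_ob s x)) ∘
      ec_kappa Y (ef_ob x) (map ef_ob s) ∘ mt_map E (pairmaps ef_hom x s)
}.
Arguments ef_hom {_ _ _ _} _ _ _.

Section CastLemmas.
Variable C : Category.

Lemma cast_hom_id (x : C) (e : x = x) : cast_hom e = idm x.
Proof. by rewrite (Prop_irrelevance e erefl). Qed.

Lemma cast_homM (x y z : C) (e : x = y) (e' : y = z) :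
  cast_hom e' ∘ cast_hom e = cast_hom (etrans e e').
Proof. by case: _ / e'; rewrite comp1m; congr cast_hom. Qed.

Lemma cast_hom_eq (x y : C) (e e' : x = y) : cast_hom e = cast_hom e'.
Proof. by rewrite (Prop_irrelevance e e'). Qed.

Definition cast_homs (s t : seq C) (e : s = t) : homs s t :=
  let: erefl := e in idms s.
Arguments cast_homs : simpl never.

Lemma cast_homs_cons (x : C) (s t : seq C) (e : s = t) (e' : x :: s = x :: t) :
  cast_homs e' = (idm x, cast_homs e).
Proof. by case: _ / e e' => e'; rewrite (Prop_irrelevance e' erefl). Qed.

Lemma cast_homs_nil (e : [::] = [::] :> seq C) : cast_homs e = tt.
Proof. by case: (cast_homs e). Qed.

Lemma mt_map_cast (E : FamilyFunctor C) (s t : seq C) (e : s = t) :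
  mt_map E (cast_homs e) = cast_hom (congr1 E e).
Proof. by case: _ / e; rewrite /cast_homs /= mt_map1. Qed.

End CastLemmas.

Section ECat.
Variables (C : Category) (E : Multitensor C).

Lemma ec_kappa_cast (X : ECategory E) (x : X) (s t : seq X) (e : s = t)
    (e1 : ec_hom X x (last x t) = ec_hom X x (last x s))
    (e2 : E (pairmap (ec_hom X) x s) = E (pairmap (ec_hom X) x t)) :
  ec_kappa X x s = cast_hom e1 ∘ ec_kappa X x t ∘ cast_hom e2.
Proof. by case: _ / e e1 e2 => e1 e2; rewrite !cast_hom_id comp1m compm1. Qed.

Lemma EFunctor_ext (X Y : ECategory E) (f0 : X -> Y)
    (f1 f1' : forall x y, hom (ec_hom X x y) (ec_hom Y (f0 x) (f0 y))) p p' :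
  f1 = f1' -> @Build_EFunctor _ _ X Y f0 f1 p = @Build_EFunctor _ _ X Y f0 f1' p'.
Proof. by move=> e; case: _ / e p' => p'; congr Build_EFunctor. Qed.

Lemma pairmaps_id (X : ECategory E) (x : X) (s : seq X) e :
  pairmaps (f0 := fun y => y) (fun y z => idm (ec_hom X y z)) x s = cast_homs e.
Proof.
elim: s x e => [|y s IH] x e /=; first exact/esym/cast_homs_nil.
have e' : pairmap (ec_hom X) y s = pairmap (ec_hom X) y (map id s).
  by rewrite map_id.
by rewrite (IH y e'); exact/esym/cast_homs_cons.
Qed.

Program Definition idEF (X : ECategory E) : EFunctor X X :=
  {| ef_ob := fun x => x; ef_hom := fun x y => idm (ec_hom X x y) |}.
Next Obligation.
move=> X x s.
have em : s = map (fun y => y) s by elim: s => //= y s {1}->.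
have e := congr1 (pairmap (ec_hom X) x) em.
rewrite (pairmaps_id e) mt_map_cast comp1m.
exact: ec_kappa_cast.
Qed.

Lemma pairmaps_comp (X Y Z : ECategory E) (g : EFunctor Y Z) (f : EFunctor X Y)
    (x : X) (s : seq X) e :
  comps (pairmaps (ef_hom g) (f x) (map f s)) (pairmaps (ef_hom f) x s) =
  comps (cast_homs e)
    (pairmaps (fun y z => ef_hom g (f y) (f z) ∘ ef_hom f y z)
       (f0 := fun y => g (f y)) x s).
Proof.
elim: s x e => [|y s IH] x e /=; first by [].
have e' : pairmap (ec_hom Z) (g (f y)) (map (fun y => g (f y)) s) =
  pairmap (ec_hom Z) (g (f y)) (map g (map f s)) by rewrite -map_comp.
by rewrite [cast_homs e](cast_homs_cons e' e) (IH y e') /= comp1m.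
Qed.

Program Definition compEF (X Y Z : ECategory E)
    (g : EFunctor Y Z) (f : EFunctor X Y) : EFunctor X Z :=
  {| ef_ob := fun x => g (f x);
     ef_hom := fun x y => ef_hom g (f x) (f y) ∘ ef_hom f x y |}.
Next Obligation.
move=> X Y Z g f x s /=.
rewrite -compA ef_kappa !compA.
have nat_cast a b (e : a = b) (e1 : ec_hom Y (f x) a = ec_hom Y (f x) b)
    (e2 : ec_hom Z (g (f x)) (g a) = ec_hom Z (g (f x)) (g b)) :
    ef_hom g (f x) b ∘ cast_hom e1 = cast_hom e2 ∘ ef_hom g (f x) a.
  by case: _ / e e1 e2 => e1 e2; rewrite !cast_hom_id compm1 comp1m.
rewrite (nat_cast _ _ (last_map f s x) _
  (congr1 (fun a => ec_hom Z (g (f x)) (g a)) (last_map f s x))).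
rewrite -(compA (cast_hom _)) ef_kappa !compA -compA -mt_mapM.
have em : map (fun y => g (f y)) s = map g (map f s) by rewrite -map_comp.
have e := congr1 (pairmap (ec_hom Z) (g (f x))) em.
rewrite (pairmaps_comp e) mt_mapM mt_map_cast compA cast_homM.
congr (_ ∘ _).
have e1 : ec_hom Z (g (f x)) (last (g (f x)) (map g (map f s))) =
  ec_hom Z (g (f x)) (last (g (f x)) (map (fun y => g (f y)) s)).
  by rewrite em.
rewrite (ec_kappa_cast em e1 (congr1 E e)) !compA cast_homM.
by congr (_ ∘ _ ∘ _); apply: cast_hom_eq.
Qed.

Program Definition ECat : Category :=
  {| obj := ECategory E; hom := @EFunctor C E; idm := idEF; comp := compEF |}.
Next Obligation.
move=> X Y Z W h g f; apply: EFunctor_ext.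
by apply: functional_extensionality_dep => x;
   apply: functional_extensionality_dep => y; rewrite compA.
Qed.
Next Obligation.
move=> X Y [f0 f1 p]; apply: EFunctor_ext.
by apply: functional_extensionality_dep => x;
   apply: functional_extensionality_dep => y; rewrite comp1m.
Qed.
Next Obligation.
move=> X Y [f0 f1 p]; apply: EFunctor_ext.
by apply: functional_extensionality_dep => x;
   apply: functional_extensionality_dep => y; rewrite compm1.
Qed.

Definition ECat_ob : Functor ECat SetCat :=
  @Build_Functor ECat SetCat (fun X => ec_ob X) (fun X Y f => ef_ob f)
    (fun _ => erefl) (fun _ _ _ _ _ => erefl).

End ECat.

Record Monad (C : Category) := {
  mon_fun :> Functor C C;
  mon_eta : forall x : C, hom x (mon_fun x);
  mon_etaN : forall (x y : C) (f : hom x y),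
    fmap mon_fun f ∘ mon_eta x = mon_eta y ∘ f;
  mon_mu : forall x : C, hom (mon_fun (mon_fun x)) (mon_fun x);
  mon_muN : forall (x y : C) (f : hom x y),
    fmap mon_fun f ∘ mon_mu x = mon_mu y ∘ fmap mon_fun (fmap mon_fun f);
  mon_mu_eta : forall x : C, mon_mu x ∘ mon_eta (mon_fun x) = idm (mon_fun x);
  mon_mu_Teta : forall x : C,
    mon_mu x ∘ fmap mon_fun (mon_eta x) = idm (mon_fun x);
  mon_muA : forall x : C,
    mon_mu x ∘ mon_mu (mon_fun x) = mon_mu x ∘ fmap mon_fun (mon_mu x)
}.
Arguments mon_eta {_} _ _.
Arguments mon_mu {_} _ _.

Record Algebra (C : Category) (T : Monad C) := {
  car :> C;
  act : hom (T car) car;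
  act_eta : act ∘ mon_eta T car = idm car;
  act_mu : act ∘ mon_mu T car = act ∘ fmap T act
}.

Record AlgHom (C : Category) (T : Monad C) (A B : Algebra T) := {
  ah_map :> hom (car A) (car B);
  ah_act : ah_map ∘ act A = act B ∘ fmap T ah_map
}.

Lemma AlgHom_ext (C : Category) (T : Monad C) (A B : Algebra T)
  (f g : AlgHom A B) : ah_map f = ah_map g -> f = g.
Proof.
case: f g => [f pf] [g pg] /= e; case: _ / e pg => pg.
by congr Build_AlgHom.
Qed.

Section AlgCat.
Variables (C : Category) (T : Monad C).

Program Definition idAH (A : Algebra T) : AlgHom A A := {| ah_map := idm A |}.
Next Obligation. by move=> A; rewrite fmap1 comp1m compm1. Qed.

Program Definition compAH (A B D : Algebra T) (g : AlgHom B D)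
  (f : AlgHom A B) : AlgHom A D := {| ah_map := ah_map g ∘ ah_map f |}.
Next Obligation.
by move=> A B D g f; rewrite fmapM -compA ah_act compA ah_act compA.
Qed.

Program Definition Alg : Category :=
  {| obj := Algebra T; hom := @AlgHom C T; idm := idAH; comp := compAH |}.
Next Obligation. by move=> *; apply: AlgHom_ext; rewrite /= compA. Qed.
Next Obligation. by move=> *; apply: AlgHom_ext; rewrite /= comp1m. Qed.
Next Obligation. by move=> *; apply: AlgHom_ext; rewrite /= compm1. Qed.

End AlgCat.

Section LegsOps.
Variable C : Category.

Fixpoint lpost (A : C) (s t : seq C) : homs s t -> legs A s -> legs A t :=
  match s, t with
  | [::], [::] => fun _ l => l
  | x :: s', y :: t' => fun h l => (h.1 ∘ l.1, lpost h.2 l.2)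
  | _, _ => fun h => match h with end
  end.

Fixpoint lcat_map (S : Type) (f : S -> C) (A : C) (s t : seq S) :
    legs A (map f s) -> legs A (map f t) -> legs A (map f (s ++ t)) :=
  if s is x :: s' then fun l k => (l.1, lcat_map l.2 k) else fun _ k => k.

Lemma lpost_id (A : C) s (l : legs A s) : lpost (idms s) l = l.
Proof. by elim: s l => //= x s IH [f l] /=; rewrite comp1m IH. Qed.

Lemma lpostM (A : C) s t u (g : homs t u) (f : homs s t) (l : legs A s) :
  lpost (comps g f) l = lpost g (lpost f l).
Proof.
elim: s t u g f l => [|x s IH] [|y t] [|z u] //= g f l; try by case: g; case: f.
by rewrite compA IH.
Qed.

Lemma lpre_post (A B : C) s t (h : homs s t) (l : legs A s) (f : hom B A) :
  lpre f (lpost h l) = lpost h (lpre f l).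
Proof. by elim: s t h l => [|x s IH] [|y t] //= h l; rewrite -?compA ?IH. Qed.

Lemma lpre_cat_map (S : Type) (F : S -> C) (A B : C) (s t : seq S)
    (l : legs A (map F s)) (k : legs A (map F t)) (f : hom B A) :
  lpre f (lcat_map l k) = lcat_map (lpre f l) (lpre f k).
Proof. by elim: s l => //= x s IH [g l] /=; rewrite IH. Qed.

End LegsOps.

Fixpoint lfmap (C D : Category) (F : Functor C D) (A : C) (s : seq C) :
    legs A s -> legs (F A) (map F s) :=
  if s is x :: s' then fun l => (fmap F l.1, lfmap F l.2) else fun l => l.

Lemma lfmap_pre (C D : Category) (F : Functor C D) (A B : C) s
  (l : legs A s) (f : hom B A) : lfmap F (lpre f l) = lpre (fmap F f) (lfmap F l).
Proof. by elim: s l => //= x s IH [g l] /=; rewrite fmapM IH. Qed.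

Lemma lfmap_post (C D : Category) (F : Functor C D) (A : C) s t
    (l : legs A s) (h : homs s t) :
  lfmap F (lpost h l) = lpost (fmaps F h) (lfmap F l).
Proof. by elim: s t l h => [|x s IH] [|y t] //= l h; rewrite fmapM IH. Qed.

Lemma fmaps_id (C D : Category) (F : Functor C D) (s : seq C) :
  fmaps F (idms s) = idms (map F s).
Proof. by elim: s => //= x s IH; rewrite /fmaps /= fmap1 -IH. Qed.

Lemma fmaps_comp (C D : Category) (F : Functor C D) (s t u : seq C)
  (g : homs t u) (f : homs s t) :
  fmaps F (comps g f) = comps (fmaps F g) (fmaps F f).
Proof.
elim: s t u g f => [|x s IH] [|y t] [|z u] //= g f; try by case: g; case: f.
by rewrite /fmaps /= fmapM -[in LHS]/(fmaps F (comps g.2 f.2)) IH.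
Qed.

Definition prod_map (C : Category) (s t : seq C) (P : Product s)
    (Q : Product t) (h : homs s t) : hom P Q :=
  tup Q (lpost h (prj P)).

Section TTimes.
Variables (C : Category) (P : FinProducts C) (T : Monad C).
Implicit Types (A B : C) (s t : seq C).

Definition tx_ob s : C := P (map T s).

Definition tx_map s t (h : homs s t) : hom (tx_ob s) (tx_ob t) :=
  prod_map _ _ (fmaps T h).

(* The chosen product P [:: T x] of a one-term sequence need not be T x, so
   the unit is eta followed by the canonical isomorphism. *)
Definition tx_u (x : C) : hom x (tx_ob [:: x]) :=
  tup (P [:: T x]) ((mon_eta T x, tt) : legs x [:: T x]).

Definition comparison s : hom (T (P s)) (P (map T s)) :=
  tup (P (map T s)) (lfmap T (prj (P s))).

Fixpoint mus s : homs (map T (map T s)) (map T s) :=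
  if s is x :: s' then (mon_mu T x, mus s') else tt.

Definition prod_TT s : C := P (map T (map T s)).

Fixpoint comparisons (ss : seq (seq C)) :
    homs (map T (map tx_ob ss)) (map prod_TT ss) :=
  if ss is s :: ss' then (comparison (map T s), comparisons ss') else tt.

(* From a family into the products prod_TT s_i, take all projections and
   compose them with mu. *)
Fixpoint collapse A (ss : seq (seq C)) :
    legs A (map prod_TT ss) -> legs A (map T (flatten ss)) :=
  if ss is s :: ss' then
    fun l => lcat_map (lpost (mus s) (lpre l.1 (prj (P (map T (map T s))))))
                      (collapse l.2)
  else fun l => l.

Definition tx_sigma (ss : seq (seq C)) :
    hom (tx_ob (map tx_ob ss)) (tx_ob (flatten ss)) :=
  tup (P (map T (flatten ss))) (collapse (prj (P (map prod_TT ss)))) ∘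
  prod_map (P (map T (map tx_ob ss))) (P (map prod_TT ss)) (comparisons ss).

Program Definition tx_fun : FamilyFunctor C :=
  {| mt_ob := tx_ob; mt_map := tx_map |}.
Next Obligation.
move=> s; rewrite /tx_map /prod_map fmaps_id lpost_id.
by apply: (@prod_ext _ _ (P (map T s))); rewrite tupK lpre1.
Qed.
Next Obligation.
move=> s t u g f; apply: (@prod_ext _ _ (P (map T u))).
by rewrite /tx_map /prod_map lpreM !tupK lpre_post tupK fmaps_comp lpostM.
Qed.

Definition tx_ext A s (l : legs A (map T s)) : legs (T A) (map T s) :=
  lpost (mus s) (lfmap T l).

Definition tx_act A s (f : hom A (T (tx_ob s))) : legs A (map T s) :=
  lpre f (tx_ext (prj (P (map T s)))).

Definition tx_legs A := fix tx_legs (ss : seq (seq C)) :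
    legs A (map T (map tx_ob ss)) -> legs A (map T (flatten ss)) :=
  if ss is s :: ss' then fun l => lcat_map (tx_act l.1) (tx_legs ss' l.2)
  else fun l => l.
Arguments tx_legs {A} ss l : rename.

Lemma tx_legs_collapse A ss (l : legs A (map T (map tx_ob ss))) :
  collapse (lpost (comparisons ss) l) = tx_legs ss l.
Proof.
elim: ss l => //= s ss IH [f l] /=; rewrite IH; congr lcat_map.
by rewrite /tx_act /tx_ext lpreM tupK lpre_post.
Qed.

Lemma collapse_pre A B ss (l : legs A (map prod_TT ss)) (f : hom B A) :
  lpre f (collapse l) = collapse (lpre f l).
Proof.
elim: ss l => //= s ss IH [g l] /=.
by rewrite lpre_cat_map IH lpre_post lpreM.
Qed.

Lemma tx_sigma_legs A ss (f : hom A (tx_ob (map tx_ob ss))) :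
  lpre (tx_sigma ss ∘ f) (prj (P (map T (flatten ss)))) =
  tx_legs ss (lpre f (prj (P (map T (map tx_ob ss))))).
Proof.
rewrite /tx_sigma !lpreM tupK -tx_legs_collapse collapse_pre tupK.
by rewrite collapse_pre lpre_post.
Qed.

Lemma tx_legs_pre A B ss (l : legs A (map T (map tx_ob ss))) (f : hom B A) :
  lpre f (tx_legs ss l) = tx_legs ss (lpre f l).
Proof. by rewrite -!tx_legs_collapse collapse_pre lpre_post. Qed.

Lemma tx_ext_pre A B s (l : legs A (map T s)) (f : hom B A) :
  tx_ext (lpre f l) = lpre (fmap T f) (tx_ext l).
Proof. by rewrite /tx_ext lfmap_pre lpre_post. Qed.

Lemma mus_nat s t (h : homs s t) A (l : legs A (map T (map T s))) :
  lpost (mus t) (lpost (fmaps T (fmaps T h)) l) = lpost (fmaps T h) (lpost (mus s) l).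
Proof.
elim: s t h l => [|x s IH] [|y t] //= h l.
by rewrite !compA -mon_muN -[in LHS]/(fmaps T (fmaps T h.2)) IH.
Qed.

Lemma tx_ext_post s t (h : homs s t) A (l : legs A (map T s)) :
  tx_ext (lpost (fmaps T h) l) = lpost (fmaps T h) (tx_ext l).
Proof. by rewrite /tx_ext lfmap_post mus_nat. Qed.

Lemma lpost_cat s1 t1 s2 t2 (h : homs s1 t1) (k : homs s2 t2) A
    (l : legs A (map T s1)) (l' : legs A (map T s2)) :
  lpost (fmaps T (rel2_cat h k : homs _ _)) (lcat_map l l') =
  lcat_map (lpost (fmaps T h) l) (lpost (fmaps T k) l').
Proof.
elim: s1 t1 h l => [|x s1 IH] [|y t1] //= h l.
by rewrite -[in RHS]/(fmaps T h.2) -IH.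
Qed.

Lemma tx_act_nat s t (h : homs s t) A (f : hom A (T (tx_ob s))) :
  tx_act (fmap T (tx_map h) ∘ f) = lpost (fmaps T h) (tx_act f).
Proof.
by rewrite /tx_act lpreM -tx_ext_pre /tx_map tupK tx_ext_post lpre_post.
Qed.

Lemma tx_legs_post (ss ts : seq (seq C)) (h : rel2 (@homs C) ss ts) A
    (l : legs A (map T (map tx_ob ss))) :
  tx_legs ts (lpost (fmaps T (rel2_map tx_map h : homs _ _)) l) =
  lpost (fmaps T (rel2_flatten h : homs _ _)) (tx_legs ss l).
Proof.
elim: ss ts h l => [|s ss IH] [|t ts] //= h l.
by rewrite lpost_cat -IH -tx_act_nat.
Qed.

Lemma tx_sigmaN (ss ts : seq (seq C)) (h : rel2 (@homs C) ss ts) :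
  tx_sigma ts ∘ tx_map (rel2_map tx_map h) =
  tx_map (rel2_flatten h) ∘ tx_sigma ss.
Proof.
apply: (@prod_ext _ _ (P (map T (flatten ts)))).
rewrite tx_sigma_legs lpreM !tupK lpre_post -(compm1 (tx_sigma ss)) tx_sigma_legs lpre1.
exact: tx_legs_post.
Qed.

Definition lcast A s t (e : s = t) (l : legs A s) : legs A t := let: erefl := e in l.

Lemma lpre_cast s t (e : s = t) (e' : tx_ob s = tx_ob t) A (f : hom A (tx_ob s)) :
  lpre (cast_hom e' ∘ f) (prj (P (map T t))) =
  lcast (congr1 (map T) e) (lpre f (prj (P (map T s)))).
Proof. by case: _ / e e' => e'; rewrite cast_hom_id comp1m. Qed.

Lemma lcast_id A s (e : s = s) (l : legs A s) : lcast e l = l.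
Proof. by rewrite (Prop_irrelevance e erefl). Qed.

Lemma lcast_cons A x s t (e : s = t) (e' : x :: s = x :: t) (f : hom A x)
  (l : legs A s) : lcast (A := A) e' ((f, l) : legs A (x :: s)) = (f, lcast e l).
Proof. by case: _ / e e' => e'; rewrite lcast_id. Qed.

Lemma tx_ext_eta s A (l : legs A (map T s)) :
  lpre (mon_eta T A) (tx_ext l) = l.
Proof.
elim: s l => //= x s IH [f l] /=; rewrite -[in RHS](IH l); congr pair.
by rewrite -compA mon_etaN compA mon_mu_eta comp1m.
Qed.

Lemma lcat_nil A s (l : legs A (map T s)) e :
  lcat_map (t := [::]) l (tt : legs A (map T [::])) = lcast (s := map T s) e l.
Proof.
elim: s l e => [|x s IH] /= l e; first by rewrite lcast_id; case: l.
have e' : map T s = map T (s ++ [::]) by rewrite cats0.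
by case: l => f l; rewrite (lcast_cons e') (IH _ e').
Qed.

Lemma tx_sigma_u s :
  tx_sigma [:: s] ∘ tx_u (tx_ob s) = cast_hom (congr1 tx_ob (esym (cats0 s))).
Proof.
apply: (@prod_ext _ _ (P (map T (flatten [:: s])))).
rewrite tx_sigma_legs /tx_u tupK /= -[cast_hom _]compm1.
rewrite (lpre_cast (esym (cats0 s))) lpre1 -lcat_nil /tx_act.
by rewrite tx_ext_eta.
Qed.

Lemma tx_legs_us s A (l : legs A (map T s)) e :
  tx_legs (map (fun x => [:: x]) s)
    (lpost (fmaps T (mt_us (E := tx_fun) tx_u s)) l) = lcast e l.
Proof.
elim: s l e => [|x s IH] l e; first by rewrite lcast_id.
case: l => f l /=.
have e' : map T s = map T (flatten (map (fun x => [:: x]) s)).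
  by rewrite flatten_seq1.
rewrite (lcast_cons e') -[in LHS]/(fmaps T (mt_us (E := tx_fun) tx_u s)).
rewrite (IH _ e'); congr pair.
rewrite -!compA (compA (fmap T _)) -fmapM.
have := tupK (P [:: T x]) ((mon_eta T x, tt) : legs x [:: T x]).
by case=> ->; rewrite compA mon_mu_Teta comp1m.
Qed.

Lemma tx_sigma_us s :
  tx_sigma (map (fun x => [:: x]) s) ∘ tx_map (mt_us (E := tx_fun) tx_u s) =
  cast_hom (congr1 tx_ob (esym (flatten_seq1 s))).
Proof.
apply: (@prod_ext _ _ (P (map T (flatten (map (fun x => [:: x]) s))))).
rewrite tx_sigma_legs -[cast_hom _]compm1 (lpre_cast (esym (flatten_seq1 s))) lpre1.
by rewrite /tx_map tupK; apply: tx_legs_us.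
Qed.

Lemma mus_assoc s A (l : legs A (map T (map T (map T s)))) :
  lpost (mus s) (lpost (mus (map T s)) l) = lpost (mus s) (lpost (fmaps T (mus s)) l).
Proof.
elim: s l => //= x s IH l; rewrite !compA mon_muA.
by rewrite -[in RHS]/(fmaps T (mus s)) -IH.
Qed.

Lemma tx_ext_ext s A (l : legs A (map T s)) :
  tx_ext (tx_ext l) = lpre (mon_mu T A) (tx_ext l).
Proof.
have muN : lpre (mon_mu T A) (lfmap T l) =
    lpost (mus (map T s)) (lfmap T (lfmap T l)).
  by elim: s l => //= x s IH [g l] /=; rewrite mon_muN IH.
by rewrite /tx_ext lfmap_post lpre_post muN mus_assoc.
Qed.

Lemma tx_ext_act s A (f : hom A (T (tx_ob s))) :
  tx_ext (tx_act f) = tx_act (mon_mu T _ ∘ fmap T f).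
Proof.
by rewrite /tx_act tx_ext_pre lpreM tx_ext_ext.
Qed.

Lemma tx_ext_cat s t A (l : legs A (map T s)) (k : legs A (map T t)) :
  tx_ext (lcat_map l k) = lcat_map (tx_ext l) (tx_ext k).
Proof. by elim: s l => //= x s IH l; rewrite /tx_ext /=; congr pair; apply: IH. Qed.

Lemma tx_ext_legs ss A (l : legs A (map T (map tx_ob ss))) : tx_ext (tx_legs ss l) = tx_legs ss (tx_ext l).
Proof. by elim: ss l => //= s ss IH l; rewrite tx_ext_cat tx_ext_act IH. Qed.

Lemma tx_act_sigma ss A (f : hom A (T (tx_ob (map tx_ob ss)))) :
  tx_act (fmap T (tx_sigma ss) ∘ f) = tx_legs ss (tx_act f).
Proof.
rewrite /tx_act lpreM -tx_ext_pre -[tx_sigma ss]compm1 tx_sigma_legs lpre1 tx_ext_legs.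
by rewrite tx_legs_pre.
Qed.

Lemma lcat_cast A s t1 t2 (l : legs A (map T s)) (k : legs A (map T t1))
    (e : map T t1 = map T t2) (e' : map T (s ++ t1) = map T (s ++ t2)) :
  lcat_map l (lcast e k) = lcast e' (lcat_map l k).
Proof.
elim: s l e' => [|x s IH] /= l e'; first by congr lcast.
have e1 : map T (s ++ t1) = map T (s ++ t2) by rewrite !map_cat e.
by rewrite (lcast_cons e1) (IH _ e1).
Qed.

Lemma lcat_mapA A s t r (l : legs A (map T s)) (k : legs A (map T t))
    (m : legs A (map T r)) (e : map T (s ++ (t ++ r)) = map T ((s ++ t) ++ r)) :
  lcat_map (lcat_map l k) m = lcast e (lcat_map l (lcat_map k m)).
Proof.
elim: s l e => [|x s IH] /= l e; first by rewrite lcast_id.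
have e1 : map T (s ++ (t ++ r)) = map T ((s ++ t) ++ r) by rewrite catA.
by rewrite (lcast_cons e1) (IH _ e1).
Qed.

Lemma lcastM A s t u (e : s = t) (e' : t = u) (e2 : s = u)
  (l : legs A s) : lcast e' (lcast e l) = lcast e2 l.
Proof. by case: _ / e' e2; case: _ / e => e2; rewrite !lcast_id. Qed.

Lemma tx_legs_cat ss ts A (l : legs A (map T (map tx_ob ss)))
    (k : legs A (map T (map tx_ob ts))) e e' :
  tx_legs (ss ++ ts) (lcast e' (lcat_map (f := T) (s := map tx_ob ss) l k)) =
  lcast e (lcat_map (tx_legs ss l) (tx_legs ts k)).
Proof.
elim: ss l e e' => [|s ss IH] l e e' /=; first by rewrite !lcast_id.
have e1 : map T (map tx_ob ss ++ map tx_ob ts) = map T (map tx_ob (ss ++ ts)).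
  by rewrite (map_cat tx_ob).
rewrite (lcast_cons e1) /=.
have e2 : map T (flatten ss ++ flatten ts) = map T (flatten (ss ++ ts)).
  by rewrite flatten_cat.
have e3 : map T (s ++ (flatten ss ++ flatten ts)) = map T (s ++ flatten (ss ++ ts)).
  by rewrite flatten_cat.
rewrite (IH _ e2) (lcat_cast _ _ _ e3).
have e4 : map T (s ++ (flatten ss ++ flatten ts)) =
  map T ((s ++ flatten ss) ++ flatten ts) by rewrite catA.
have -> : lcat_map (lcat_map (tx_act l.1) (tx_legs ss l.2)) (tx_legs ts k) =
    lcast e4 (lcat_map (tx_act l.1) (lcat_map (tx_legs ss l.2) (tx_legs ts k))).
  exact: lcat_mapA.
by rewrite (lcastM _ _ e3).
Qed.

Lemma tx_legs_assoc (sss : seq (seq (seq C))) A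
    (l : legs A (map T (map tx_ob (map (map tx_ob) sss)))) e1 e2 :
  lcast e1 (tx_legs (map flatten sss)
    (lpost (fmaps T (mt_sigmas (E := tx_fun) tx_sigma sss)) l)) =
  tx_legs (flatten sss) (lcast e2 (tx_legs (map (map tx_ob) sss) l)).
Proof.
elim: sss l e1 e2 => [|ss sss IH] l e1 e2 /=; first by rewrite !lcast_id.
rewrite tx_act_sigma.
rewrite -[lpost _ l.2]/(lpost (fmaps T (mt_sigmas (E := tx_fun) tx_sigma sss)) l.2).
have e3 : map T (flatten (map (map tx_ob) sss)) = map T (map tx_ob (flatten sss)).
  by rewrite (map_flatten tx_ob).
have e4 : map T (map tx_ob ss ++ flatten (map (map tx_ob) sss)) =
    map T (map tx_ob ss ++ map tx_ob (flatten sss)).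
  by rewrite (map_flatten tx_ob).
have e5 : map T (map tx_ob ss ++ map tx_ob (flatten sss)) =
    map T (map tx_ob (ss ++ flatten sss)).
  by rewrite (map_cat tx_ob).
rewrite -(lcastM e4 e5) -(lcat_cast _ _ e3).
have e6 : map T (flatten ss ++ flatten (flatten sss)) =
    map T (flatten (ss ++ flatten sss)).
  by rewrite flatten_cat.
rewrite (tx_legs_cat _ _ e6).
have e7 : map T (flatten (map flatten sss)) = map T (flatten (flatten sss)).
  by rewrite flatten_flatten.
rewrite -(IH _ e7 e3).
have e8 : map T (flatten ss ++ flatten (map flatten sss)) =
    map T (flatten ss ++ flatten (flatten sss)).
  by rewrite flatten_flatten.
by rewrite (lcat_cast _ _ _ e8) (lcastM _ _ e1).
Qed.

Lemma tx_sigmaA (sss : seq (seq (seq C))) :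
  cast_hom (congr1 tx_ob (flatten_flatten sss)) ∘ tx_sigma (map flatten sss) ∘
    tx_map (mt_sigmas (E := tx_fun) tx_sigma sss) =
  tx_sigma (flatten sss) ∘
    cast_hom (congr1 tx_ob (esym (map_flatten tx_ob sss))) ∘
    tx_sigma (map (map tx_ob) sss).
Proof.
apply: (@prod_ext _ _ (P (map T (flatten (flatten sss))))).
rewrite -(compA (cast_hom _) (tx_sigma _)) -(compA (tx_sigma _) (cast_hom _)).
rewrite (lpre_cast (flatten_flatten sss)) !tx_sigma_legs /tx_map tupK.
rewrite (lpre_cast (esym (map_flatten tx_ob sss))).
rewrite -[X in _ = tx_legs _ (lcast _ (lpre X _))]compm1 tx_sigma_legs lpre1.
exact: tx_legs_assoc.
Qed.

Lemma tx_uN (x y : C) (f : hom x y) :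
  tx_u y ∘ f = tx_map ((f, tt) : homs [:: x] [:: y]) ∘ tx_u x.
Proof.
apply: (@prod_ext _ _ (P (map T [:: y]))).
rewrite !lpreM /tx_map /prod_map !tupK lpre_post tupK /=.
by rewrite mon_etaN.
Qed.

Definition TTimes : Multitensor C :=
  @Build_Multitensor C tx_fun tx_u tx_uN tx_sigma tx_sigmaN
    tx_sigma_u tx_sigma_us tx_sigmaA.

End TTimes.

Section AlgProducts.
Variables (C : Category) (P : FinProducts C) (T : Monad C).

Definition Alg_forget : Functor (Alg T) C :=
  @Build_Functor (Alg T) C (fun A => car A) (fun A B f => ah_map f)
    (fun _ => erefl) (fun _ _ _ _ _ => erefl).

Local Notation U := Alg_forget.

Fixpoint acts (s : seq (Alg T)) : homs (map T (map U s)) (map U s) :=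
  if s is A :: s' then (act A, acts s') else tt.

Definition alg_prod_act (s : seq (Alg T)) : hom (T (P (map U s))) (P (map U s)) :=
  tup (P (map U s)) (lpost (acts s) (lfmap T (prj (P (map U s))))).

Lemma acts_eta (s : seq (Alg T)) (B : C) (l : legs B (map U s)) :
  lpre (mon_eta T B) (lpost (acts s) (lfmap T l)) = l.
Proof.
elim: s l => //= A s IH [f l] /=; rewrite IH; congr pair.
by rewrite -compA mon_etaN compA act_eta comp1m.
Qed.

Lemma acts_mu (s : seq (Alg T)) (B : C) (l : legs B (map U s)) :
  lpre (mon_mu T B) (lpost (acts s) (lfmap T l)) =
  lpost (acts s) (lfmap T (lpost (acts s) (lfmap T l))).
Proof.
elim: s l => //= A s IH [f l] /=; rewrite IH; congr pair.
by rewrite -compA mon_muN compA act_mu -compA -fmapM.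
Qed.

Program Definition alg_prod (s : seq (Alg T)) : Algebra T :=
  {| car := P (map U s); act := alg_prod_act s |}.
Next Obligation.
move=> s; apply: (@prod_ext _ _ (P (map U s))).
by rewrite lpreM tupK acts_eta lpre1.
Qed.
Next Obligation.
move=> s; apply: (@prod_ext _ _ (P (map U s))).
by rewrite !lpreM tupK acts_mu lpre_post -lfmap_pre tupK.
Qed.

Fixpoint alg_legs (A : Alg T) (s : seq (Alg T)) :
    forall l : legs (U A) (map U s),
      lpre (act A) l = lpost (acts s) (lfmap T l) -> legs A s :=
  match s with
  | [::] => fun l _ => l
  | B :: s' => fun l e =>
      (@Build_AlgHom C T A B l.1 (congr1 fst e), alg_legs (congr1 snd e))
  end.

Lemma alg_legsK (A : Alg T) s (l : legs (U A) (map U s)) e :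
  lfmap U (alg_legs (l := l) e) = l.
Proof. by elim: s l e => //= B s IH [f l] /= e; rewrite IH. Qed.

Lemma forget_legs_inj (A : Alg T) s (l k : legs A s) :
  lfmap U l = lfmap U k -> l = k.
Proof.
elim: s l k => //= B s IH [f l] [g k] /= [/AlgHom_ext-> e].
by rewrite (IH l k e).
Qed.

Lemma forget_legs_act (A : Alg T) s (l : legs A s) :
  lpre (act A) (lfmap U l) = lpost (acts s) (lfmap T (lfmap U l)).
Proof. by elim: s l => //= B s IH [f l] /=; rewrite ah_act IH. Qed.

Program Definition alg_tup (s : seq (Alg T)) (A : Alg T) (l : legs A s) :
    AlgHom A (alg_prod s) :=
  {| ah_map := tup (P (map U s)) (lfmap U l) |}.
Next Obligation.
move=> s A l; apply: (@prod_ext _ _ (P (map U s))).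
rewrite !lpreM /= /alg_prod_act !tupK forget_legs_act.
by rewrite lpre_post -lfmap_pre tupK.
Qed.

Lemma alg_prj_subproof (s : seq (Alg T)) :
  lpre (act (alg_prod s)) (prj (P (map U s))) =
  lpost (acts s) (lfmap T (prj (P (map U s)))).
Proof. by rewrite /= tupK. Qed.

Program Definition AlgProducts : FinProducts (Alg T) := fun s =>
  {| prd := alg_prod s : Alg T;
     prj := alg_legs (alg_prj_subproof s);
     tup := @alg_tup s |}.
Next Obligation.
move=> s A l; apply: forget_legs_inj.
by rewrite lfmap_pre alg_legsK /= tupK.
Qed.
Next Obligation.
move=> s A f; apply: AlgHom_ext => /=.
by rewrite lfmap_pre alg_legsK /= prjK.
Qed.

End AlgProducts.
Arguments AlgProducts {C} P T s.

Record Monoidal (W : Category) := {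
  ten : W -> W -> W;
  tenm : forall x x' y y' : W,
    hom x x' -> hom y y' -> hom (ten x y) (ten x' y');
  tenm1 : forall x y : W, tenm (idm x) (idm y) = idm (ten x y);
  tenmM : forall (x x' x'' y y' y'' : W)
    (f' : hom x' x'') (f : hom x x') (g' : hom y' y'') (g : hom y y'),
    tenm (f' ∘ f) (g' ∘ g) = tenm f' g' ∘ tenm f g;
  unt : W;
  assoc : forall x y z : W, hom (ten (ten x y) z) (ten x (ten y z));
  assoc_iso : forall x y z : W, is_iso (assoc x y z);
  assocN : forall (x x' y y' z z' : W)
    (f : hom x x') (g : hom y y') (h : hom z z'),
    assoc x' y' z' ∘ tenm (tenm f g) h = tenm f (tenm g h) ∘ assoc x y z;
  lunit : forall x : W, hom (ten unt x) x;
  lunit_iso : forall x : W, is_iso (lunit x);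
  lunitN : forall (x x' : W) (f : hom x x'),
    lunit x' ∘ tenm (idm unt) f = f ∘ lunit x;
  runit : forall x : W, hom (ten x unt) x;
  runit_iso : forall x : W, is_iso (runit x);
  runitN : forall (x x' : W) (f : hom x x'),
    runit x' ∘ tenm f (idm unt) = f ∘ runit x;
  triangle : forall x y : W,
    tenm (idm x) (lunit y) ∘ assoc x unt y = tenm (runit x) (idm y);
  pentagon : forall x y z w : W,
    assoc x y (ten z w) ∘ assoc (ten x y) z w =
    tenm (idm x) (assoc y z w) ∘ assoc x (ten y z) w ∘
      tenm (assoc x y z) (idm w)
}.
Arguments ten {_} _ _ _.
Arguments tenm {_} _ {_ _ _ _} _ _.
Arguments unt {_} _.
Arguments assoc {_} _ _ _ _.
Arguments lunit {_} _ _.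
Arguments runit {_} _ _.

Section Cartesian.
Variables (W : Category) (P : FinProducts W).
Implicit Types A B D : W.

Definition bprod A B : W := P [:: A; B].
Definition bfst A B : hom (bprod A B) A := (prj (P [:: A; B])).1.
Definition bsnd A B : hom (bprod A B) B := (prj (P [:: A; B])).2.1.
Definition bpair D A B (f : hom D A) (g : hom D B) : hom D (bprod A B) :=
  tup (P [:: A; B]) ((f, (g, tt)) : legs D [:: A; B]).
Definition bterm : W := P [::].
Definition bbang D : hom D bterm := tup (P [::]) (tt : legs D [::]).

Lemma bfst_pair D A B (f : hom D A) (g : hom D B) : bfst A B ∘ bpair f g = f.
Proof. by case: (tupK (P [:: A; B]) ((f, (g, tt)) : legs D [:: A; B])). Qed.

Lemma bsnd_pair D A B (f : hom D A) (g : hom D B) : bsnd A B ∘ bpair f g = g.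
Proof. by case: (tupK (P [:: A; B]) ((f, (g, tt)) : legs D [:: A; B])). Qed.

Lemma bprod_ext D A B (f g : hom D (bprod A B)) :
  bfst A B ∘ f = bfst A B ∘ g -> bsnd A B ∘ f = bsnd A B ∘ g -> f = g.
Proof.
move=> e1 e2; apply: (@prod_ext _ _ (P [:: A; B])) => /=.
by congr (_, (_, _)); [exact: e1 | exact: e2].
Qed.

Lemma bterm_ext D (f g : hom D bterm) : f = g.
Proof. by apply: (@prod_ext _ _ (P [::])). Qed.

Definition bmap A A' B B' (f : hom A A') (g : hom B B') :
    hom (bprod A B) (bprod A' B') :=
  bpair (f ∘ bfst A B) (g ∘ bsnd A B).

Definition bassoc A B D :
    hom (bprod (bprod A B) D) (bprod A (bprod B D)) :=
  bpair (bfst A B ∘ bfst _ _) (bpair (bsnd A B ∘ bfst _ _) (bsnd _ _)).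

Lemma bfst_map A A' B B' (f : hom A A') (g : hom B B') :
  bfst A' B' ∘ bmap f g = f ∘ bfst A B.
Proof. exact: bfst_pair. Qed.

Lemma bsnd_map A A' B B' (f : hom A A') (g : hom B B') :
  bsnd A' B' ∘ bmap f g = g ∘ bsnd A B.
Proof. exact: bsnd_pair. Qed.

Lemma bfst_pair_l D A B E (f : hom D A) (g : hom D B) (h : hom A E) :
  h ∘ bfst A B ∘ bpair f g = h ∘ f.
Proof. by rewrite -compA bfst_pair. Qed.

Lemma bsnd_pair_l D A B E (f : hom D A) (g : hom D B) (h : hom B E) :
  h ∘ bsnd A B ∘ bpair f g = h ∘ g.
Proof. by rewrite -compA bsnd_pair. Qed.

Local Ltac cart := rewrite /bmap /bassoc;
  repeat first
    [ reflexivity | apply: bprod_ext | apply: bterm_ext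
    | progress rewrite ?comp1m ?compm1 ?compA ?bfst_pair ?bsnd_pair
        ?bfst_pair_l ?bsnd_pair_l ].

Program Definition Cartesian : Monoidal W :=
  {| ten := bprod; tenm := bmap; unt := bterm; assoc := bassoc;
     lunit := fun A => bsnd bterm A; runit := fun A => bfst A bterm |}.
Next Obligation. by move=> *; cart. Qed.
Next Obligation. by move=> *; cart. Qed.
Next Obligation.
move=> A B D; exists (bpair (bpair (bfst _ _) (bfst _ _ ∘ bsnd A (bprod B D)))
                       (bsnd _ _ ∘ bsnd _ _)).
by split; cart.
Qed.
Next Obligation. by move=> *; cart. Qed.
Next Obligation. by move=> A; exists (bpair (bbang A) (idm A)); split; cart. Qed.
Next Obligation. by move=> *; cart. Qed.
Next Obligation. by move=> A; exists (bpair (idm A) (bbang A)); split; cart. Qed.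
Next Obligation. by move=> *; cart. Qed.
Next Obligation. by move=> *; cart. Qed.
Next Obligation. by move=> *; cart. Qed.

End Cartesian.

(* Composition is written in diagrammatic order, as for E-categories. *)
Record EnrichedCategory (W : Category) (M : Monoidal W) := {
  vc_ob :> Type;
  vc_hom : vc_ob -> vc_ob -> W;
  vc_id : forall x, hom (unt M) (vc_hom x x);
  vc_comp : forall x y z,
    hom (ten M (vc_hom x y) (vc_hom y z)) (vc_hom x z);
  vc_compA : forall x y z w,
    vc_comp x y w ∘ tenm M (idm (vc_hom x y)) (vc_comp y z w) ∘
      assoc M (vc_hom x y) (vc_hom y z) (vc_hom z w) =
    vc_comp x z w ∘ tenm M (vc_comp x y z) (idm (vc_hom z w));
  vc_comp1l : forall x y,
    vc_comp x x y ∘ tenm M (vc_id x) (idm (vc_hom x y)) =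
    lunit M (vc_hom x y);
  vc_comp1r : forall x y,
    vc_comp x y y ∘ tenm M (idm (vc_hom x y)) (vc_id y) =
    runit M (vc_hom x y)
}.
Arguments vc_hom {_ _} _ _ _.
Arguments vc_id {_ _} _ _.
Arguments vc_comp {_ _} _ _ _ _.

Record EnrichedFunctor (W : Category) (M : Monoidal W)
    (X Y : EnrichedCategory M) := {
  vf_ob :> X -> Y;
  vf_hom : forall x y, hom (vc_hom X x y) (vc_hom Y (vf_ob x) (vf_ob y));
  vf_id : forall x, vf_hom x x ∘ vc_id X x = vc_id Y (vf_ob x);
  vf_comp : forall x y z,
    vf_hom x z ∘ vc_comp X x y z =
    vc_comp Y (vf_ob x) (vf_ob y) (vf_ob z) ∘ tenm M (vf_hom x y) (vf_hom y z)
}.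
Arguments vf_hom {_ _ _ _} _ _ _.

Section EnrichedCat.
Variables (W : Category) (M : Monoidal W).

Lemma EnrichedFunctor_ext (X Y : EnrichedCategory M) (f0 : X -> Y)
    (f1 f1' : forall x y, hom (vc_hom X x y) (vc_hom Y (f0 x) (f0 y)))
    p q p' q' :
  f1 = f1' ->
  @Build_EnrichedFunctor _ _ X Y f0 f1 p q =
  @Build_EnrichedFunctor _ _ X Y f0 f1' p' q'.
Proof.
by move=> e; case: _ / e p' q' => p' q'; congr Build_EnrichedFunctor.
Qed.

Program Definition idVF (X : EnrichedCategory M) : EnrichedFunctor X X :=
  {| vf_ob := fun x => x; vf_hom := fun x y => idm (vc_hom X x y) |}.
Next Obligation. by move=> *; rewrite comp1m. Qed.
Next Obligation. by move=> *; rewrite tenm1 comp1m compm1. Qed.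

Program Definition compVF (X Y Z : EnrichedCategory M)
    (g : EnrichedFunctor Y Z) (f : EnrichedFunctor X Y) : EnrichedFunctor X Z :=
  {| vf_ob := fun x => g (f x);
     vf_hom := fun x y => vf_hom g (f x) (f y) ∘ vf_hom f x y |}.
Next Obligation. by move=> *; rewrite -compA !vf_id. Qed.
Next Obligation.
by move=> *; rewrite -compA vf_comp compA vf_comp tenmM compA.
Qed.

Program Definition EnrichedCat : Category :=
  {| obj := EnrichedCategory M; hom := @EnrichedFunctor W M;
     idm := idVF; comp := compVF |}.
Next Obligation.
move=> X Y Z V h g f; apply: EnrichedFunctor_ext.
by apply: functional_extensionality_dep => x;
   apply: functional_extensionality_dep => y; rewrite compA.
Qed.
Next Obligation.
move=> X Y [f0 f1 p q]; apply: EnrichedFunctor_ext.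
by apply: functional_extensionality_dep => x;
   apply: functional_extensionality_dep => y; rewrite comp1m.
Qed.
Next Obligation.
move=> X Y [f0 f1 p q]; apply: EnrichedFunctor_ext.
by apply: functional_extensionality_dep => x;
   apply: functional_extensionality_dep => y; rewrite compm1.
Qed.

Definition EnrichedCat_ob : Functor EnrichedCat SetCat :=
  @Build_Functor EnrichedCat SetCat (fun X => vc_ob X) (fun X Y f => vf_ob f)
    (fun _ => erefl) (fun _ _ _ _ _ => erefl).

End EnrichedCat.

(* Main.v *)
(* Writing a structure map kappa on generalized elements, the unary kappa makes
   each hom object X(x,y) a T-algebra with action a, and the associativity of
   kappa gives

     kappa(t_1, ..., t_n) = m(a t_1, ..., a t_n),  m = kappa o (eta, ..., eta),

   where m_n is an iterate of the algebra map m_2, with unit m_0 : 1 -> X(x,x).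
   So kappa amounts to algebra structures on the hom objects together with a
   composition enriched over T-algebras, and conversely kappa is recovered from
   these by folding.  Both passages leave the objects, the underlying hom
   objects and the maps between them unchanged. *)

From mathcomp Require Import all_boot.
From mathcomp Require Import boolp.
Require Import Defs.

Set Implicit Arguments.
Unset Strict Implicit.
Unset Printing Implicit Defensive.
#[local] Obligation Tactic := idtac.

Local Open Scope cat_scope.

(** * Strict equality of functors and of structured objects *)

Lemma Functor_ext (C D : Category) (F G : Functor C D) (e : forall x, F x = G x) :
  (forall x y (f : hom x y),
     cast_hom (e y) ∘ fmap F f = fmap G f ∘ cast_hom (e x)) -> F = G.
Proof.
case: F G e => [F Ff F1 FM] [G Gf G1 GM] /= e.
have eFG : F = G by apply: functional_extensionality_dep.
(* With the object maps identified, every transport in the hypothesis runs along a loop and is an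
   identity. *)
case: _ / eFG Gf G1 GM e => Gf G1 GM e eFf.
have {}eFf : Ff = Gf.
  apply: functional_extensionality_dep => x; apply: functional_extensionality_dep => y.
  apply: functional_extensionality_dep => f.
  by have := eFf x y f; rewrite !cast_hom_id comp1m compm1.
by case: _ / eFf G1 GM => G1 GM; congr Build_Functor; apply: Prop_irrelevance.
Qed.

(* To compare two functors strictly, the transport along an equality of their
   values must be computed, so the equality comes with its [cast_hom]. *)
Lemma EnrichedFunctor_cast (W : Category) (M : Monoidal W) (X0 : Type)
    (h k : X0 -> X0 -> W) i c pA pl pr i' c' pA' pl' pr'
    (X := @Build_EnrichedCategory W M X0 h i c pA pl pr)
    (Y := @Build_EnrichedCategory W M X0 k i' c' pA' pl' pr')
    (f : forall x y, hom (h x y) (k x y))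
    (p : forall x, f x x ∘ i x = i' x)
    (q : forall x y z, f x z ∘ c x y z = c' x y z ∘ tenm M (f x y) (f y z)) :
  (forall x y, exists e : h x y = k x y, f x y = cast_hom e) ->
  exists e : X = Y :> EnrichedCat M,
    cast_hom e = @Build_EnrichedFunctor W M X Y (fun x => x) f p q.
Proof.
move=> ef; rewrite {}/X {}/Y.
have ehk : h = k.
  apply: functional_extensionality_dep => x; apply: functional_extensionality_dep => y.
  by have [] := ef x y.
case: _ / ehk i' c' pA' pl' pr' f p q ef => i' c' pA' pl' pr' f p q ef.
have {}ef : f = fun x y => idm (h x y).
  apply: functional_extensionality_dep => x; apply: functional_extensionality_dep => y.
  by have [e ->] := ef x y; rewrite cast_hom_id.
rewrite {}ef in p q *.
have ei : i = i'.
  by apply: functional_extensionality_dep => x; rewrite -p comp1m.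
have ec : c = c'.
  apply: functional_extensionality_dep => x; apply: functional_extensionality_dep => y.
  by apply: functional_extensionality_dep => z; rewrite -[RHS]compm1 -tenm1 -q comp1m.
case: _ / ei pl' pr' p; case: _ / ec pA' q => pA' q pl' pr' p.
rewrite (Prop_irrelevance pA' pA) (Prop_irrelevance pl' pl) (Prop_irrelevance pr' pr).
by exists erefl; apply: EnrichedFunctor_ext.
Qed.

(** The passage there and back keeps hom objects definitionally, so only the structure maps need
    comparing. *)
Lemma ECategory_cast (C : Category) (E : Multitensor C) (X0 : Type)
    (h : X0 -> X0 -> C) k pu ps k' pu' ps'
    (X := @Build_ECategory C E X0 h k pu ps)
    (Y := @Build_ECategory C E X0 h k' pu' ps') :
  (forall x s, k x s = k' x s) ->
  exists (e : X = Y :> ECat E) p,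
    cast_hom e = @Build_EFunctor C E X Y (fun x => x) (fun x y => idm (h x y)) p.
Proof.
rewrite {}/X {}/Y => ek.
have {}ek : k = k'.
  by apply: functional_extensionality_dep => x; apply: functional_extensionality_dep => s.
case: _ / ek pu' ps' => pu' ps'.
rewrite (Prop_irrelevance pu' pu) (Prop_irrelevance ps' ps).
by exists erefl, (@ef_kappa _ _ _ _ (idEF _)); apply: EFunctor_ext.
Qed.

Lemma comp3_congr (C : Category) (a b c d c' d' e : C)
    (h : hom c d) (g : hom b c) (f : hom a b)
    (h' : hom d' d) (g' : hom c' d') (f' : hom a c') (k : hom e a) :
  h ∘ g ∘ f = h' ∘ g' ∘ f' -> h ∘ (g ∘ (f ∘ k)) = h' ∘ (g' ∘ (f' ∘ k)).
Proof. by rewrite !compA => ->. Qed.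

(** The tuple of all projections is the identity, so an equation out of a product may be tested on
    that one family. *)
Lemma comp3_prj (C : Category) (s : seq C) (p : Product s) (b c d c' : C)
    (h : hom c d) (g : hom b c) (f : hom p b)
    (h' : hom c' d) (b' : C) (g' : hom b' c') (f' : hom p b') :
  h ∘ (g ∘ (f ∘ tup p (prj p))) = h' ∘ (g' ∘ (f' ∘ tup p (prj p))) ->
  h ∘ g ∘ f = h' ∘ g' ∘ f'.
Proof. by rewrite -[X in tup _ X]lpre1 prjK !compA !compm1. Qed.

(** Over an identity, compatibility with the actions says that the two actions coincide. *)
Lemma AlgHom_cast (C : Category) (T : Monad C) (A B : Algebra T) (f : AlgHom A B)
    (e : car A = car B) :
  ah_map f = cast_hom e -> exists e' : A = B :> Alg T, f = cast_hom e'.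
Proof.
case: A B f e => [A a p q] [B b p' q'] f /= e; case: _ / e b p' q' f => b p' q' f.
rewrite cast_hom_id => f1.
have eab : a = b by have /= := ah_act f; rewrite f1 fmap1 comp1m compm1.
case: _ / eab p' q' f f1 => p' q' f f1.
rewrite (Prop_irrelevance p' p) (Prop_irrelevance q' q) in f f1 *.
by exists erefl; apply: AlgHom_ext.
Qed.

(** * Cartesian structure on generalized elements *)

Section CartesianElements.
Variables (W : Category) (Q : FinProducts W).
Notation pair2 := (bpair Q).

Lemma bpair_pre (A B D D' : W) (f : hom D A) (g : hom D B) (k : hom D' D) :
  pair2 f g ∘ k = pair2 (f ∘ k) (g ∘ k).
Proof. by apply: bprod_ext; rewrite compA ?bfst_pair ?bsnd_pair. Qed.

Lemma bpair_fst_snd (A B : W) : pair2 (bfst Q A B) (bsnd Q A B) = idm _.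
Proof. by apply: bprod_ext; rewrite ?bfst_pair ?bsnd_pair compm1. Qed.

Lemma bmap_pair (A A' B B' D : W) (f : hom A A') (g : hom B B')
    (h : hom D A) (k : hom D B) :
  bmap Q f g ∘ pair2 h k = pair2 (f ∘ h) (g ∘ k).
Proof. by rewrite /bmap bpair_pre bfst_pair_l bsnd_pair_l. Qed.

Lemma bassoc_pair (A B D K : W) (f : hom K A) (g : hom K B) (h : hom K D) :
  bassoc Q A B D ∘ pair2 (pair2 f g) h = pair2 f (pair2 g h).
Proof.
by rewrite /bassoc !bpair_pre !bfst_pair_l bfst_pair !bsnd_pair.
Qed.

(** A Yoneda argument: the projections of the iterated product form the universal triple. The unit
    laws below are treated in the same way. *)
Lemma associative_elements (A B D AB BD Z : W) (m : hom (bprod Q A BD) Z)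
    (n : hom (bprod Q B D) BD) (m' : hom (bprod Q AB D) Z) (n' : hom (bprod Q A B) AB) :
  (forall K (f : hom K A) (g : hom K B) (h : hom K D),
    m ∘ pair2 f (n ∘ pair2 g h) = m' ∘ pair2 (n' ∘ pair2 f g) h) <->
  m ∘ bmap Q (idm A) n ∘ bassoc Q A B D = m' ∘ bmap Q n' (idm D).
Proof.
split=> [assoc_mn | eq_mn K f g h].
  rewrite -[LHS]compm1 -[RHS]compm1 -bpair_fst_snd.
  rewrite -[X in pair2 X _]comp1m -bpair_fst_snd bpair_pre.
  by rewrite -!compA bassoc_pair !bmap_pair !comp1m.
have := congr1 (fun t => t ∘ pair2 (pair2 f g) h) eq_mn.
by rewrite -!compA bassoc_pair !bmap_pair !comp1m.
Qed.

Lemma left_unit_elements (I A B : W) (i : hom (bterm Q) I) (m : hom (bprod Q I A) B)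
    (k : hom A B) :
  (forall K (f : hom K A), m ∘ pair2 (i ∘ bbang Q K) f = k ∘ f) <->
  m ∘ bmap Q i (idm A) = k ∘ bsnd Q (bterm Q) A.
Proof.
split=> [unit_m | eq_m K f].
  rewrite -[LHS]compm1 -bpair_fst_snd -compA bmap_pair comp1m -unit_m.
  by congr (_ ∘ pair2 (_ ∘ _) _); apply: bterm_ext.
have := congr1 (fun t => t ∘ pair2 (bbang Q K) f) eq_m.
by rewrite -!compA bmap_pair comp1m bsnd_pair.
Qed.

Lemma right_unit_elements (I A B : W) (i : hom (bterm Q) I) (m : hom (bprod Q A I) B)
    (k : hom A B) :
  (forall K (f : hom K A), m ∘ pair2 f (i ∘ bbang Q K) = k ∘ f) <->
  m ∘ bmap Q (idm A) i = k ∘ bfst Q A (bterm Q).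
Proof.
split=> [unit_m | eq_m K f].
  rewrite -[LHS]compm1 -bpair_fst_snd -compA bmap_pair comp1m -unit_m.
  by congr (_ ∘ pair2 _ (_ ∘ _)); apply: bterm_ext.
have := congr1 (fun t => t ∘ pair2 f (bbang Q K)) eq_m.
by rewrite -!compA bmap_pair comp1m bfst_pair.
Qed.

End CartesianElements.

(** * The multitensor [TTimes] evaluated on tuples *)

Section Elements.
Variables (V : Category) (P : FinProducts V) (T : Monad V).
Notation E := (TTimes P T).

Lemma tx_map_tup s t (h : homs s t) A (l : legs A (map T s)) :
  tx_map P T h ∘ tup (P (map T s)) l = tup (P (map T t)) (lpost (fmaps T h) l).
Proof.
by apply: prod_ext; rewrite lpreM /tx_map /prod_map !tupK lpre_post tupK.
Qed.

Lemma tx_sigma_tup ss A (l : legs A (map T (map (tx_ob P T) ss))) :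
  tx_sigma P T ss ∘ tup (P (map T (map (tx_ob P T) ss))) l =
  tup (P (map T (flatten ss))) (tx_legs l).
Proof. by apply: prod_ext; rewrite tx_sigma_legs !tupK. Qed.

Lemma cast_hom_tup s t (e : s = t) (e0 : tx_ob P T s = tx_ob P T t) e1 A
    (l : legs A (map T s)) :
  cast_hom e0 ∘ tup (P (map T s)) l = tup (P (map T t)) (lcast e1 l).
Proof. by case: _ / e e0 e1 => e0 e1; rewrite cast_hom_id comp1m lcast_id. Qed.

(** [tx_act] applies the action of a product of free algebras, which on [T] of a tuple is Kleisli
    extension in each component. *)
Lemma tx_act_tup s A (l : legs A (map T s)) :
  tx_act (fmap T (tup (P (map T s)) l)) = tx_ext l.
Proof. by rewrite /tx_act -tx_ext_pre tupK. Qed.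

Lemma tx_act_eta s A (l : legs A (map T s)) :
  tx_act (mon_eta T _ ∘ tup (P (map T s)) l) = l.
Proof. by rewrite /tx_act lpreM tx_ext_eta tupK. Qed.

Lemma fmap_eta_comp x y A (f : hom x y) (g : hom A x) :
  fmap T f ∘ (mon_eta T x ∘ g) = mon_eta T y ∘ (f ∘ g).
Proof. by rewrite compA mon_etaN compA. Qed.

Notation AP := (AlgProducts P T).
Notation M := (Cartesian AP).

(** * From a multitensor category to a category enriched in algebras *)

Section MultitensorCategory.
Variable X : ECategory E.
Implicit Types (x y z w : X) (s : seq X) (A B : V).

Definition kap x s A (l : legs A (map T (pairmap (ec_hom X) x s))) :
    hom A (ec_hom X x (last x s)) :=
  ec_kappa X x s ∘ tup (P (map T (pairmap (ec_hom X) x s))) l.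

Arguments kap : clear implicits.
Arguments kap x s {A} l.

Lemma kap_prj x s : kap x s (prj (P (map T (pairmap (ec_hom X) x s)))) = ec_kappa X x s.
Proof. by rewrite /kap -[X in tup _ X]lpre1 prjK compm1. Qed.

Lemma kap_pre x s A B (l : legs A (map T (pairmap (ec_hom X) x s))) (f : hom B A) :
  kap x s l ∘ f = kap x s (lpre f l).
Proof. by rewrite /kap -compA tup_pre. Qed.

Lemma kap_eta x y A (f : hom A (ec_hom X x y)) :
  kap x [:: y] ((mon_eta T _ ∘ f, tt) : legs A [:: T (ec_hom X x y)]) = f.
Proof.
by rewrite -[RHS]comp1m -(ec_kappa_u x y) /= /tx_u -compA tup_pre.
Qed.

(** The associativity axiom at elements [l], one for each block. The list [s] and the transports are
    left free, so that concrete blocks can be used with their flattening in reduced form. *)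
Lemma kap_sigma x (ss : seq (seq X)) s A
    (l : legs A (map T (map (tx_ob P T) (path_blocks (ec_hom X) x ss)))) e1 e2 :
  flatten ss = s ->
  kap x s (lcast e1 (tx_legs l)) =
  cast_hom e2 ∘ kap x (scanl (fun y s => last y s) x ss)
    (lpost (fmaps T (ec_kappas (E := tx_fun P T) (ec_kappa X) x ss)) l).
Proof.
move=> es; case: _ / es e1 e2 => e1 e2.
rewrite /kap -(cast_hom_tup (esym (flatten_path_blocks _ x ss))
  (congr1 (tx_ob P T) (esym (flatten_path_blocks _ x ss)))).
rewrite -tx_sigma_tup -tx_map_tup.
rewrite (cast_hom_eq e2 (congr1 (ec_hom X x) (esym (last_scanl_last x ss)))).
exact: comp3_congr (ec_kappa_sigma x ss).
Qed.

Definition kap_act x y : hom (T (ec_hom X x y)) (ec_hom X x y) :=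
  kap x [:: y] ((idm _, tt) : legs _ [:: T (ec_hom X x y)]).

Definition kap_mul x y z A (f : hom A (ec_hom X x y)) (g : hom A (ec_hom X y z)) :
    hom A (ec_hom X x z) :=
  kap x [:: y; z] ((mon_eta T _ ∘ f, (mon_eta T _ ∘ g, tt)) :
    legs A [:: T (ec_hom X x y); T (ec_hom X y z)]).

Lemma kap_seq1 x y A (f : hom A (T (ec_hom X x y))) :
  kap x [:: y] (f, tt) = kap_act x y ∘ f.
Proof. by rewrite /kap_act (kap_pre (s := [:: y])) /= comp1m. Qed.

Lemma kap_act_eta x y : kap_act x y ∘ mon_eta T _ = idm _.
Proof. by rewrite -kap_seq1 -[RHS]kap_eta compm1. Qed.

(** Associativity for the single block [s], at [T] of the tuple [l]. The block flattens to [s ++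
    [::]], whence the transports. *)
Lemma kap_ext x s A (l : legs A (map T (pairmap (ec_hom X) x s))) :
  kap_act x (last x s) ∘ fmap T (kap x s l) = kap x s (tx_ext l).
Proof.
pose h := ec_hom X.
have e : map T (pairmap h x s) = map T (pairmap h x s ++ [::]) by rewrite cats0.
have := @kap_sigma x [:: s] s _ (fmap T (tup (P _) l), tt) (esym e) erefl (cats0 s).
rewrite cast_hom_id comp1m /= (lcat_nil _ e) (lcastM _ _ erefl) /=.
by rewrite -fmapM kap_seq1 tx_act_tup => ->.
Qed.

(** The Kleisli extension of the identity element is [mon_mu]. *)
Lemma kap_act_mu x y :
  kap_act x y ∘ mon_mu T _ = kap_act x y ∘ fmap T (kap_act x y).
Proof.
by rewrite [in RHS]/kap_act (kap_ext (s := [:: y])) /tx_ext /= fmap1 compm1 kap_seq1.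
Qed.

(** Associativity for the blocks [[:: y]] and [s], at eta of the two tuples; flattening cancels eta.
    Iterated, this expresses every [kappa] through the action, the binary product and the nullary
    case. *)
Lemma kap_cons x y s A (f : hom A (T (ec_hom X x y)))
    (l : legs A (map T (pairmap (ec_hom X) y s))) :
  kap x (y :: s) (f, l) = kap_mul (kap_act x y ∘ f) (kap y s l).
Proof.
(* The blocks [y] and s flatten to y :: (s ++ [::]), whence the transports. *)
pose h := ec_hom X.
have e : map T (pairmap h y s) = map T (pairmap h y s ++ [::]) by rewrite cats0.
have e' : T (h x y) :: map T (pairmap h y s) =
  T (h x y) :: map T (pairmap h y s ++ [::]) by rewrite cats0.
have := @kap_sigma x [:: [:: y]; s] (y :: s) A
  (mon_eta T _ ∘ tup (P _) ((f, tt) : legs A [:: T (h x y)]),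
    (mon_eta T _ ∘ tup (P _) l, tt)) (esym e') erefl.
rewrite cast_hom_id comp1m /= !fmap_eta_comp (lcat_nil _ e) tx_act_eta.
have [-> _] := tx_act_eta ((f, tt) : legs A (map T [:: h x y])).
rewrite (lcast_cons (esym e)) (lcastM _ _ erefl) /= => ->; last by rewrite cats0.
by rewrite -[ec_kappa X x [:: y] ∘ _]/(kap x [:: y] (f, tt)) kap_seq1.
Qed.

Lemma kap_mul_nil x y A (f : hom A (ec_hom X x y)) :
  kap_mul f (kap y [::] tt) = f.
Proof.
by rewrite -[in LHS](kap_eta f) kap_seq1 -kap_cons kap_eta.
Qed.

(** Here the empty block comes first, which [kap_cons] does not cover, so associativity is used for
    the blocks [[::]] and [[:: y]]. *)
Lemma kap_nil_mul x y A (f : hom A (ec_hom X x y)) :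
  kap_mul (kap x [::] tt) f = f.
Proof.
have := @kap_sigma x [:: [::]; [:: y]] [:: y] A
  (mon_eta T _ ∘ tup (P [::]) (tt : legs A [::]),
    (mon_eta T _ ∘ tup (P _) ((mon_eta T _ ∘ f, tt) : legs A (map T [:: ec_hom X x y])), tt))
  erefl erefl erefl.
rewrite cast_hom_id comp1m /= !fmap_eta_comp.
have [-> _] := tx_act_eta ((mon_eta T _ ∘ f, tt) : legs A (map T [:: ec_hom X x y])).
by rewrite kap_eta -[ec_kappa X x [:: y] ∘ _]/(kap x [:: y] (_, tt)) kap_eta => {2}->.
Qed.

(** Both bracketings equal a ternary [kappa]: one by [kap_cons], the other by associativity for the
    blocks [[:: y; z]] and [[:: w]]. *)
Lemma kap_mulA x y z w A (f : hom A (ec_hom X x y)) (g : hom A (ec_hom X y z))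
    (h : hom A (ec_hom X z w)) :
  kap_mul f (kap_mul g h) = kap_mul (kap_mul f g) h.
Proof.
transitivity (kap x [:: y; z; w] (mon_eta T _ ∘ f, (mon_eta T _ ∘ g, (mon_eta T _ ∘ h, tt)))).
  by rewrite kap_cons -kap_seq1 kap_eta.
have := @kap_sigma x [:: [:: y; z]; [:: w]] [:: y; z; w] A
  (mon_eta T _ ∘ tup (P _) ((mon_eta T _ ∘ f, (mon_eta T _ ∘ g, tt)) :
     legs A (map T [:: ec_hom X x y; ec_hom X y z])),
    (mon_eta T _ ∘ tup (P _) ((mon_eta T _ ∘ h, tt) : legs A (map T [:: ec_hom X z w])), tt))
  erefl erefl erefl.
rewrite cast_hom_id comp1m /= !fmap_eta_comp.
have [-> _] := tx_act_eta ((mon_eta T _ ∘ h, tt) : legs A (map T [:: ec_hom X z w])).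
have [-> -> _] := tx_act_eta ((mon_eta T _ ∘ f, (mon_eta T _ ∘ g, tt)) :
     legs A (map T [:: ec_hom X x y; ec_hom X y z])).
by rewrite -[ec_kappa X z [:: w] ∘ _]/(kap z [:: w] (_, tt)) kap_eta => ->.
Qed.

(** Both sides are [kappa] at T f and T g: the left by [kap_ext], where mu cancels T eta, the right
    by [kap_cons]. This makes composition a map of algebras. *)
Lemma kap_act_mul x y z A (f : hom A (ec_hom X x y)) (g : hom A (ec_hom X y z)) :
  kap_act x z ∘ fmap T (kap_mul f g) =
  kap_mul (kap_act x y ∘ fmap T f) (kap_act y z ∘ fmap T g).
Proof.
transitivity (kap x [:: y; z] (fmap T f, (fmap T g, tt))); last by rewrite kap_cons kap_seq1.
by rewrite (kap_ext (s := [:: y; z])) /tx_ext /= !fmapM !compA !mon_mu_Teta !comp1m.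
Qed.

Lemma kap_mul_pre x y z A B (f : hom A (ec_hom X x y)) (g : hom A (ec_hom X y z))
    (k : hom B A) :
  kap_mul f g ∘ k = kap_mul (f ∘ k) (g ∘ k).
Proof. by rewrite /kap_mul (kap_pre (s := [:: y; z])) /= !compA. Qed.

Definition kap_alg x y : Alg T :=
  @Build_Algebra V T (ec_hom X x y) (kap_act x y) (kap_act_eta x y) (kap_act_mu x y).

Program Definition kap_id x : AlgHom (AP [::] : Alg T) (kap_alg x x) :=
  {| ah_map := ec_kappa X x [::] |}.
Next Obligation.
move=> x /=; rewrite -kap_prj /=.
(* Both sides become the nullary [kappa] of a family without entries. *)
rewrite [RHS](kap_ext (s := [::])) [LHS](kap_pre (s := [::])).
exact: erefl.
Qed.

Program Definition kap_comp x y z :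
    AlgHom (AP [:: kap_alg x y; kap_alg y z] : Alg T) (kap_alg x z) :=
  {| ah_map := kap_mul (bfst P (ec_hom X x y) (ec_hom X y z))
                       (bsnd P (ec_hom X x y) (ec_hom X y z)) |}.
Next Obligation.
move=> x y z; rewrite [RHS]kap_act_mul [LHS]kap_mul_pre /= /alg_prod_act.
have [e1 e2] := tupK (P (map (Alg_forget T) [:: kap_alg x y; kap_alg y z]))
  (lpost (acts [:: kap_alg x y; kap_alg y z]) (lfmap T (prj (P _)))).
exact: (congr2 (@kap_mul x y z _) e1 e2).
Qed.

Lemma kap_comp_pair x y z A (f : hom A (ec_hom X x y)) (g : hom A (ec_hom X y z)) :
  ah_map (kap_comp x y z) ∘ bpair P f g = kap_mul f g.
Proof. by rewrite kap_mul_pre bfst_pair bsnd_pair. Qed.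

Program Definition enriched_of_ecat : EnrichedCategory M :=
  {| vc_ob := ec_ob X; vc_hom := kap_alg; vc_id := kap_id; vc_comp := kap_comp |}.
Next Obligation.
move=> x y z w; apply: AlgHom_ext.
(* The underlying maps of products of algebras are those of [P] by conversion, so the diagram can be
   tested on elements in [V]. *)
apply/(@associative_elements V P) => A f g h.
by rewrite !kap_comp_pair kap_mulA.
Qed.
Next Obligation.
move=> x y; apply: AlgHom_ext; rewrite -[RHS]comp1m.
apply/(@left_unit_elements V P) => A f.
by rewrite kap_comp_pair kap_nil_mul comp1m.
Qed.
Next Obligation.
move=> x y; apply: AlgHom_ext; rewrite -[RHS]comp1m.
apply/(@right_unit_elements V P) => A f.
by rewrite kap_comp_pair kap_mul_nil comp1m.
Qed.

End MultitensorCategory.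

(** * From an enriched category to a multitensor category by folding *)

Section EnrichedCategoryElements.
Variable X : EnrichedCategory M.
Implicit Types (x y z w : X) (s : seq X) (A B : V).

Definition under x y : V := car (vc_hom X x y).

Definition vmul x y z A (f : hom A (under x y)) (g : hom A (under y z)) :
    hom A (under x z) :=
  ah_map (vc_comp X x y z) ∘ bpair P f g.

Definition vunit x A : hom A (under x x) := ah_map (vc_id X x) ∘ bbang P A.

Lemma vmul_pre x y z A B (f : hom A (under x y)) (g : hom A (under y z)) (k : hom B A) :
  vmul f g ∘ k = vmul (f ∘ k) (g ∘ k).
Proof. by rewrite /vmul -compA bpair_pre. Qed.

Lemma vunit_pre x A B (k : hom B A) : vunit x A ∘ k = vunit x B.
Proof. by rewrite /vunit -compA; congr (_ ∘ _); apply: bterm_ext. Qed.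

Lemma vmulA x y z w A (f : hom A (under x y)) (g : hom A (under y z))
    (h : hom A (under z w)) : vmul f (vmul g h) = vmul (vmul f g) h.
Proof.
by move/(congr1 (@ah_map V T _ _))/(@associative_elements V P): (vc_compA x y z w); apply.
Qed.

Lemma vunit_mul x y A (f : hom A (under x y)) : vmul (vunit x A) f = f.
Proof.
have := congr1 (@ah_map V T _ _) (vc_comp1l x y); rewrite -[X in _ = X -> _]comp1m.
by move/(@left_unit_elements V P) => /(_ A f); rewrite comp1m.
Qed.

Lemma vmul_unit x y A (f : hom A (under x y)) : vmul f (vunit y A) = f.
Proof.
have := congr1 (@ah_map V T _ _) (vc_comp1r x y); rewrite -[X in _ = X -> _]comp1m.
by move/(@right_unit_elements V P) => /(_ A f); rewrite comp1m.
Qed.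

(** Composition is a map of algebras, and the action on a binary product is componentwise. *)
Lemma act_vmul x y z A (f : hom A (under x y)) (g : hom A (under y z)) :
  act (vc_hom X x z) ∘ fmap T (vmul f g) =
  vmul (act (vc_hom X x y) ∘ fmap T f) (act (vc_hom X y z) ∘ fmap T g).
Proof.
rewrite /vmul fmapM compA -ah_act -compA; congr (_ ∘ _).
by rewrite [LHS]tup_pre lpre_post -lfmap_pre tupK.
Qed.

Lemma act_vunit x A : act (vc_hom X x x) ∘ fmap T (vunit x A) = vunit x (T A).
Proof.
rewrite /vunit fmapM compA -ah_act -compA; congr (_ ∘ _).
exact: bterm_ext.
Qed.

Lemma vmul_cast x y z z' A (f : hom A (under x y)) (g : hom A (under y z)) e e' :
  z = z' -> vmul f (cast_hom e ∘ g) = cast_hom (y := under x z') e' ∘ vmul f g.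
Proof. by move=> ez; case: _ / ez e e' => e e'; rewrite !cast_hom_id !comp1m. Qed.

(** Every fold ends in the unit, so the unary fold is the action only up to [vmul_unit]. *)
Fixpoint vfold x s A : legs A (map T (pairmap under x s)) -> hom A (under x (last x s)) :=
  match s with
  | [::] => fun _ => vunit x A
  | y :: s' => fun l => vmul (act (vc_hom X x y) ∘ l.1) (vfold (x := y) (s := s') l.2)
  end.
Arguments vfold x s {A} l.

Lemma vfold_pre x s A B (l : legs A (map T (pairmap under x s))) (k : hom B A) :
  vfold x s l ∘ k = vfold x s (lpre k l).
Proof.
elim: s x l => [|y s IH] x l /=; first exact: vunit_pre.
by rewrite vmul_pre IH compA.
Qed.

(** Unit and composition are maps of algebras, so the action passes through the fold; at each entry
    [act_mu] matches the Kleisli extension. *)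
Lemma vfold_ext x s A (l : legs A (map T (pairmap under x s))) :
  vfold x s (tx_ext l) = act (vc_hom X x (last x s)) ∘ fmap T (vfold x s l).
Proof.
elim: s x l => [|y s IH] x l /=; first by rewrite act_vunit.
by rewrite act_vmul -IH fmapM !compA act_mu.
Qed.

(** Induction on the first list, with the left unit law for the empty list and associativity for
    each added factor. *)
Lemma vfold_cat x s s' A (l : legs A (map T (pairmap under x s)))
    (k : legs A (map T (pairmap under (last x s) s'))) e e' :
  vfold x (s ++ s') (lcast e (lcat_map l k)) =
  cast_hom e' ∘ vmul (vfold x s l) (vfold (last x s) s' k).
Proof.
elim: s x l k e e' => [|y s IH] x l k e e' /=.
  by rewrite lcast_id cast_hom_id comp1m vunit_mul.
have e1 : map T (pairmap under y s ++ pairmap under (last y s) s') =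
    map T (pairmap under y (s ++ s')) by rewrite pairmap_cat.
rewrite (lcast_cons e1) /= (IH _ _ _ _ (congr1 (under y) (esym (last_cat y s s')))).
by rewrite (vmul_cast _ _ _ e') ?vmulA // last_cat.
Qed.

Definition fold_kappa x s : hom (tx_ob P T (pairmap under x s)) (under x (last x s)) :=
  vfold x s (prj (P (map T (pairmap under x s)))).

Lemma fold_kappa_tup x s A (l : legs A (map T (pairmap under x s))) :
  fold_kappa x s ∘ tup (P (map T (pairmap under x s))) l = vfold x s l.
Proof. by rewrite /fold_kappa vfold_pre tupK. Qed.

(** Induction on the blocks: [vfold_cat] splits off the first one, and [vfold_ext] rewrites its part
    as the action applied to its own fold. *)
Lemma vfold_sigma x (ss : seq (seq X)) A
    (l : legs A (map T (map (tx_ob P T) (path_blocks under x ss)))) e e' :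
  vfold x (flatten ss) (lcast e (tx_legs l)) =
  cast_hom e' ∘ vfold x (scanl (fun y s => last y s) x ss)
    (lpost (fmaps T (ec_kappas (E := tx_fun P T) fold_kappa x ss)) l).
Proof.
elim: ss x l e e' => [|s ss IH] x l e e'; first by rewrite lcast_id cast_hom_id comp1m.
case: l => f l; rewrite [tx_legs _]/=.
have e1 : map T (flatten (path_blocks under (last x s) ss)) =
  map T (pairmap under (last x s) (flatten ss)) by rewrite flatten_path_blocks.
have e2 : map T (pairmap under x s ++ flatten (path_blocks under (last x s) ss)) =
  map T (pairmap under x s ++ pairmap under (last x s) (flatten ss)).
  by rewrite flatten_path_blocks.
have e3 : map T (pairmap under x s ++ pairmap under (last x s) (flatten ss)) =
  map T (pairmap under x (s ++ flatten ss)) by rewrite pairmap_cat.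
rewrite -(lcastM e2 e3) -(lcat_cast _ _ e1).
rewrite (vfold_cat _ _ _ (congr1 (under x) (esym (last_cat x s (flatten ss))))).
rewrite (IH _ _ _ (congr1 (under (last x s)) (esym (last_scanl_last (last x s) ss)))).
rewrite (vmul_cast _ _ _ (congr1 (under x) (esym (last_scanl_last (last x s) ss)))) /=; last first.
  by rewrite last_scanl_last.
rewrite compA cast_homM (cast_hom_eq _ e').
have -> // : vfold x s (tx_act f) =
  act (vc_hom X x (last x s)) ∘ (fmap T (fold_kappa x s) ∘ f).
by rewrite /tx_act -vfold_pre vfold_ext compA.
Qed.

Program Definition ecat_of_enriched : ECategory E :=
  {| ec_ob := vc_ob X; ec_hom := under; ec_kappa := fold_kappa |}.
Next Obligation.
move=> x y; rewrite [LHS]fold_kappa_tup /=.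
by rewrite vmul_unit act_eta.
Qed.
Next Obligation.
move=> x ss; apply: comp3_prj => /=.
rewrite tx_sigma_tup tx_map_tup.
have e : map T (flatten (path_blocks under x ss)) = map T (pairmap under x (flatten ss)).
  by rewrite flatten_path_blocks.
rewrite (cast_hom_tup (esym (flatten_path_blocks under x ss)) _ e).
by rewrite !fold_kappa_tup; apply: vfold_sigma.
Qed.

End EnrichedCategoryElements.
Arguments kap X x s {A} l.
Arguments kap_act : clear implicits.
Arguments kap_alg : clear implicits.
Arguments kap_id : clear implicits.
Arguments kap_comp : clear implicits.
Arguments under : clear implicits.
Arguments vunit : clear implicits.
Arguments kap_mul X {x y z A} f g.
Arguments vmul X {x y z A} f g.
Arguments vfold X x s {A} l.

(** * The two passages on functors *)

Section EnrichedFunctorOfEFunctor.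
Variables (X Y : ECategory E) (f : EFunctor X Y).

Lemma ef_kap (x : X) (s : seq X) A (l : legs A (map T (pairmap (ec_hom X) x s))) e :
  ef_hom f x (last x s) ∘ kap X x s l =
  cast_hom e ∘ kap Y (f x) (map f s) (lpost (fmaps T (pairmaps (ef_hom f) x s)) l).
Proof.
rewrite /kap compA ef_kappa -tx_map_tup -!compA.
by rewrite (cast_hom_eq e (congr1 (ec_hom Y (f x)) (last_map f s x))).
Qed.

(** The unary case of compatibility with [kappa]; it makes each component a map of algebras. *)
Lemma ef_kap_act (x y : X) :
  ef_hom f x y ∘ kap_act X x y = kap_act Y (f x) (f y) ∘ fmap T (ef_hom f x y).
Proof.
by rewrite [LHS](ef_kap (s := [:: y]) _ erefl) cast_hom_id comp1m /= compm1 kap_seq1.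
Qed.

Lemma ef_kap_mul (x y z : X) A (g : hom A (ec_hom X x y)) (h : hom A (ec_hom X y z)) :
  ef_hom f x z ∘ kap_mul X g h = kap_mul Y (ef_hom f x y ∘ g) (ef_hom f y z ∘ h).
Proof.
rewrite [LHS](ef_kap (s := [:: y; z]) _ erefl) cast_hom_id comp1m /=.
by rewrite !fmap_eta_comp.
Qed.

Program Definition enriched_of_efunctor :
    EnrichedFunctor (enriched_of_ecat X) (enriched_of_ecat Y) :=
  {| vf_ob := ef_ob f;
     vf_hom := fun x y => @Build_AlgHom V T (kap_alg X x y) (kap_alg Y (f x) (f y))
       (ef_hom f x y) (ef_kap_act x y) |}.
Next Obligation.
move=> x; apply: AlgHom_ext => /=.
rewrite -!kap_prj [LHS](ef_kap (s := [::]) _ erefl) cast_hom_id comp1m.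
exact: erefl.
Qed.
Next Obligation.
move=> x y z; apply: AlgHom_ext.
rewrite [LHS]ef_kap_mul.
exact/esym/kap_comp_pair.
Qed.

End EnrichedFunctorOfEFunctor.

Section EFunctorOfEnrichedFunctor.
Variables (X Y : EnrichedCategory M) (f : EnrichedFunctor X Y).

Definition vf_under (x y : X) : hom (under X x y) (under Y (f x) (f y)) :=
  ah_map (vf_hom f x y).

Lemma vf_vunit (x : X) A : vf_under x x ∘ vunit X x A = vunit Y (f x) A.
Proof.
rewrite /vunit compA; congr (_ ∘ _).
by have := congr1 (@ah_map V T _ _) (vf_id f x).
Qed.

Lemma vf_vmul (x y z : X) A (g : hom A (under X x y)) (h : hom A (under X y z)) :
  vf_under x z ∘ vmul X g h = vmul Y (vf_under x y ∘ g) (vf_under y z ∘ h).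
Proof.
rewrite /vmul -bmap_pair !compA; congr (_ ∘ _).
by have := congr1 (@ah_map V T _ _) (vf_comp f x y z).
Qed.

(** A fold is built from unit, composition and actions, each of which an enriched functor
    preserves. *)
Lemma vf_vfold (x : X) (s : seq X) A (l : legs A (map T (pairmap (under X) x s))) e :
  vf_under x (last x s) ∘ vfold X x s l =
  cast_hom e ∘ vfold Y (f x) (map f s) (lpost (fmaps T (pairmaps vf_under x s)) l).
Proof.
elim: s x l e => [|y s IH] x l e /=.
  by rewrite cast_hom_id comp1m vf_vunit.
rewrite vf_vmul (IH _ _ (congr1 (under Y (f y)) (last_map f s y))).
rewrite (vmul_cast _ _ _ e) ?last_map //.
by rewrite /vf_under !compA ah_act.
Qed.

Program Definition efunctor_of_enriched :
    EFunctor (ecat_of_enriched X) (ecat_of_enriched Y) :=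
  {| ef_ob := vf_ob f; ef_hom := vf_under |}.
Next Obligation.
move=> x s /=.
apply: etrans (vf_vfold _ (congr1 (under Y (f x)) (last_map f s x))) _.
rewrite -[RHS]compA; congr (_ ∘ _).
rewrite -fold_kappa_tup -tx_map_tup.
by rewrite -[in tup _ _](lpre1 (prj _)) prjK compm1.
Qed.

End EFunctorOfEnrichedFunctor.

(** * The functors in both directions and their composites *)

Program Definition to_enriched : Functor (ECat E) (EnrichedCat M) :=
  {| fob := enriched_of_ecat; fmap := enriched_of_efunctor |}.
Next Obligation.
move=> X; apply: EnrichedFunctor_ext.
apply: functional_extensionality_dep => x; apply: functional_extensionality_dep => y.
exact: AlgHom_ext.
Qed.
Next Obligation.
move=> X Y Z g f; apply: EnrichedFunctor_ext.
apply: functional_extensionality_dep => x; apply: functional_extensionality_dep => y.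
exact: AlgHom_ext.
Qed.

Program Definition of_enriched : Functor (EnrichedCat M) (ECat E) :=
  {| fob := ecat_of_enriched; fmap := efunctor_of_enriched |}.
Next Obligation. by move=> X; apply: EFunctor_ext. Qed.
Next Obligation. by move=> X Y Z g f; apply: EFunctor_ext. Qed.

(** Induction by [kap_cons], with the nullary [kappa] as the empty fold. *)
Lemma vfold_kap (X : ECategory E) (x : X) s A
    (l : legs A (map T (pairmap (ec_hom X) x s))) :
  vfold (enriched_of_ecat X) x s l = kap X x s l.
Proof.
elim: s x l => [|y s IH] x l; first by rewrite /kap; case: l.
case: l => f l; rewrite kap_cons -IH.
exact: kap_comp_pair.
Qed.

Lemma kap_mul_of_enriched (X : EnrichedCategory M) (x y z : X) A
    (f : hom A (under X x y)) (g : hom A (under X y z)) :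
  kap_mul (ecat_of_enriched X) f g = vmul X f g.
Proof. by rewrite [LHS]fold_kappa_tup /= vmul_unit !compA !act_eta !comp1m. Qed.

Lemma to_enrichedK : comp_functor of_enriched to_enriched = id_functor (ECat E).
Proof.
have castE (X : ECat E) : exists (e : of_enriched (to_enriched X) = X) p,
    cast_hom e = @Build_EFunctor V E (of_enriched (to_enriched X)) X
      (fun x => x) (fun x y => idm (ec_hom X x y)) p.
  case: X => X0 h k pu ps; apply: ECategory_cast => x s.
  by rewrite -[RHS](kap_prj (X := Build_ECategory pu ps)) -vfold_kap.
(* [cid] extracts the equality of objects and keeps the description of its transport for the
   comparison of morphisms. *)
apply: (@Functor_ext _ _ (comp_functor _ _) (id_functor _) (fun X => sval (cid (castE X)))) => X Y f.
case: (cid (castE X)) => eX [p /= ->]; case: (cid (castE Y)) => eY [q /= ->].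
apply: EFunctor_ext.
apply: functional_extensionality_dep => x; apply: functional_extensionality_dep => y.
by rewrite compm1 [LHS]comp1m.
Qed.

Lemma of_enrichedK : comp_functor to_enriched of_enriched = id_functor (EnrichedCat M).
Proof.
have castE (X : EnrichedCat M) : exists (e : to_enriched (of_enriched X) = X) f p q,
    cast_hom e = @Build_EnrichedFunctor _ M (to_enriched (of_enriched X)) X
      (fun x => x) f p q /\ forall x y, ah_map (f x y) = idm (under X x y).
  (* The hom algebra obtained on return has the unary fold as its action. It agrees with the given
     action only by an equation, so the identity must first be shown to be a map of algebras. *)
  have f_act x y : idm (under X x y) ∘ kap_act (ecat_of_enriched X) x y =
      act (vc_hom X x y) ∘ fmap T (idm (under X x y)).
    rewrite fmap1 comp1m compm1 /kap_act [LHS]fold_kappa_tup /=.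
    by rewrite vmul_unit compm1.
  pose f x y : AlgHom (kap_alg (ecat_of_enriched X) x y) (vc_hom X x y) :=
    @Build_AlgHom V T (kap_alg (ecat_of_enriched X) x y) (vc_hom X x y) (idm _) (f_act x y).
  have f_cast x y : exists e : kap_alg (ecat_of_enriched X) x y = vc_hom X x y :> Alg T,
      f x y = cast_hom e.
    exact: (@AlgHom_cast _ _ _ _ (f x y) erefl).
  have f_id x : @comp (Alg T) _ _ _ (f x x) (kap_id (ecat_of_enriched X) x) = vc_id X x.
    apply: AlgHom_ext; rewrite /= comp1m.
    (* The returned identity is the empty fold at the terminal object, where [bbang] is the
       identity. *)
    transitivity (vunit X x (P [::])); first by [].
    by rewrite /vunit (@bterm_ext V P _ (bbang P _) (idm _)) compm1.
  have f_comp x y z : @comp (Alg T) _ _ _ (f x z) (kap_comp (ecat_of_enriched X) x y z) =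
      @comp (Alg T) _ _ _ (vc_comp X x y z) (@tenm _ M _ _ _ _ (f x y) (f y z)).
    apply: AlgHom_ext; rewrite [LHS]comp1m [LHS]kap_mul_of_enriched /=.
    by congr (_ ∘ bpair P _ _); rewrite comp1m.
  have f1 x y : ah_map (f x y) = idm (under X x y) by [].
  (* Only these properties of [f] are kept, so that [X] can be destructed for
     [EnrichedFunctor_cast]. *)
  move: f f_cast f_id f_comp f1 => {f_act}.
  case: X => X0 h i c pA pl pr f f_cast f_id f_comp f1.
  set X := Build_EnrichedCategory pA pl pr in f f_cast f_id f_comp f1 *.
  have [e eE] : exists e : to_enriched (of_enriched X) = X, cast_hom e =
      @Build_EnrichedFunctor _ M (to_enriched (of_enriched X)) X (fun x => x) f f_id f_comp.
    exact: EnrichedFunctor_cast.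
  by exists e, f, f_id, f_comp.
apply: (@Functor_ext _ _ (comp_functor _ _) (id_functor _) (fun X => sval (cid (castE X)))) => X Y f.
case: (cid (castE X)) => eX [g [p [q [/= -> g1]]]].
case: (cid (castE Y)) => eY [g' [p' [q' [/= -> g1']]]].
apply: EnrichedFunctor_ext.
apply: functional_extensionality_dep => x; apply: functional_extensionality_dep => y.
by apply: AlgHom_ext; rewrite /= g1 g1' compm1 comp1m.
Qed.

End Elements.

Theorem proposition2p8 (V : Category) (lim : FinitelyComplete V) (T : Monad V) :
  isomorphic_over
    (ECat_ob (TTimes (products_of_limits lim) T))
    (EnrichedCat_ob (Cartesian (AlgProducts (products_of_limits lim) T))).
Proof.
exists (to_enriched _ T), (of_enriched _ T); split.
- exact: to_enrichedK.
- exact: of_enrichedK.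
(* Object sets and object maps agree by conversion; only the proofs of the functor laws differ. *)
- by rewrite /comp_functor /ECat_ob /=; congr Build_Functor; apply: Prop_irrelevance.
Qed.
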